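(* Let $s\in\mathbb{N}_+$ and $0<\alpha<1$. Let $f\in C^s[0,1]$ be such that $f(0),f(1),f'(0),f'(1)\in\mathbb{Z}$ and $f^{(i)}(0)=f^{(i)}(1)=0$ for $i=2,\dots,s$. Then \[ \|(\widehat{B}_n(f))^{(s)}-f^{(s)}\|=O(n^{-\alpha})\ (n\to\infty) \] if and only if \[ \omega_\varphi^2(f^{(s)},h)=O(h^{2\alpha})\quad\text{and}\quad\omega_1(f^{(s)},h)=O(h^{\alpha})\ (h\to0+). \]
   Context: $\mathbb{N}_+=\{1,2,\dots\}$; $\|\cdot\|$ is the sup-norm on $[0,1]$; $C^s[0,1]$ is the space of real-valued $s$ times continuously differentiable functions on $[0,1]$. For $f\in C[0,1]$, $x\in[0,1]$ and $n\in\mathbb{N}_+$, \[ \widehat{B}_n(f)(x):=\sum_{k=0}^n \left\langle f\left(\tfrac{k}{n}\right)\binom{n}{k}\right\rangle x^k(1-x)^{n-k}, \] where $\langle a\rangle$ is the nearest integer to the real $a$; if $a=m+1/2$ with $m\in\mathbb{Z}$, then $\langle a\rangle$ is set to be either $m$ or $m+1$ (the choice may depend on whether $m$ is positive or negative, even or odd), and the result holds regardless of the choice made. Moduli: with $\varphi(x):=\sqrt{x(1-x)}$, for $F\in C[0,1]$ and $t>0$, \[ \omega_\varphi^2(F,t):=\sup_{0<h\le t}\|\bar\Delta^2_{h\varphi}F\|, \] where $\bar\Delta^2_{h\varphi(x)}F(x):=F(x+h\varphi(x))-2F(x)+F(x-h\varphi(x))$ if $x\pm h\varphi(x)\in[0,1]$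 and $:=0$ otherwise; and \[ \omega_1(F,t):=\sup_{|x-y|\le t,\ x,y\in[0,1]}|F(x)-F(y)|. \] The constants implicit in the $O$-symbols may depend on $f$. For $s=1$ the condition on $f^{(i)}$, $i=2,\dots,s$, is void. *)

(* Defs.v *)
From HB Require Import structures.
From mathcomp Require Import all_boot all_order all_algebra.
From mathcomp Require Import all_classical all_reals all_analysis.
Import Order.TTheory GRing.Theory Num.Theory.
Import numFieldNormedType.Exports.

Set Implicit Arguments.
Unset Strict Implicit.
Unset Printing Implicit Defensive.

Local Open Scope classical_set_scope.
Local Open Scope ring_scope.

(* A function on [0,1] is represented by a total f : R -> R; every notion below
   depends only on the values of f on [0,1]. *)

(* The points y tend to x inside [0,1], so the quotient is one-sided at 0
   and at 1. *)
Definition derivable01 (R : realType) (f : R -> R) (x : R) : Prop :=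
  cvg ((fun y => (f y - f x) / (y - x)) @ within `[0, 1] x^').

Definition deriv01 (R : realType) (f : R -> R) : R -> R := fun x =>
  lim ((fun y => (f y - f x) / (y - x)) @ within `[0, 1] x^').

Definition derivn01 (R : realType) (i : nat) (f : R -> R) : R -> R :=
  iter i (@deriv01 R) f.

(* Continuity of the lower derivatives follows from their differentiability. *)
Definition Cn01 (R : realType) (s : nat) (f : R -> R) : Prop :=
  (forall i x, (i < s)%N -> 0 <= x <= 1 -> derivable01 (derivn01 i f) x) /\
  {within `[0, 1], continuous (derivn01 s f)}.

(* The suprema below are real-valued, and sup is 0 on an unbounded set; they
   are the usual ones as long as the function is bounded on [0,1], in
   particular when it is continuous there. *)
Definition norm01 (R : realType) (g : R -> R) : R :=
  sup [set `|g x| | x in `[0, 1]].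

Definition phi (R : realType) (x : R) : R := Num.sqrt (x * (1 - x)).

Definition diff2_phi (R : realType) (F : R -> R) (h : R) : R -> R := fun x =>
  if (0 <= x + h * phi x <= 1) && (0 <= x - h * phi x <= 1)
  then F (x + h * phi x) - F x *+ 2 + F (x - h * phi x)
  else 0.

Definition omega2_phi (R : realType) (F : R -> R) (t : R) : R :=
  sup [set norm01 (diff2_phi F h) | h in `]0, t]].

Definition omega1 (R : realType) (F : R -> R) (t : R) : R :=
  sup [set `|F p.1 - F p.2| | p in
    [set p : R * R |
      [/\ 0 <= p.1 <= 1, 0 <= p.2 <= 1 & `|p.1 - p.2| <= t]]].

(* Half-integers may be rounded either way, independently of one another. *)
Definition nearest_int (R : realType) (rnd : R -> int) : Prop :=
  forall (a : R) (m : int), `|a - (rnd a)%:~R| <= `|a - m%:~R|.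

Definition bernstein_int (R : realType) (rnd : R -> int) (n : nat)
    (f : R -> R) : R -> R := fun x =>
  \sum_(k < n.+1)
    (rnd (f (k%:R / n%:R) * 'C(n, k)%:R))%:~R * x ^+ k * (1 - x) ^+ (n - k).

(* Main.v *)
(* Idea. Put g = f^(s) and m = n - s, and write B_m g for the Bernstein polynomial
   of g. The s-th derivative of the integer Bernstein polynomial of degree n is
   the Bernstein form of degree m with coefficients n (n - 1) ... (n - s + 1)
   times the s-th differences of the rounded values of f. These coefficients are
   g(k / m) + O(omega_1(g, 1 / n) + 1 / n): by Taylor's formula for the part
   coming from f, while the rounding error at k is at most c n^(- s - 1) if
   s < k < n - s, because then C(n, k) >= c n^(s + 1), and otherwise at most the
   Taylor remainder at the nearer endpoint, because there C(n, k) times the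
   Taylor polynomial of f at k / n is an integer.

   It remains to compare g with B_m g. If |B_m g - g| = O(m^(- alpha)), then K_m,
   the maximum of x (1 - x) |(B_m g)''|, satisfies K_(A m) <= c m^(1 - alpha) + 2 K_m
   for each fixed A, by the Bernstein-type inequalities
   |x (1 - x) (B_m h)''| <= 5 m |h| and
   |x (1 - x) (B_m p)''| <= 2 max |x (1 - x) p''|; for A large this gives
   K_m = O(m^(1 - alpha)), whence the bound for omega_phi^2. The same recursion,
   with derivatives of order s + 1 of the integer Bernstein polynomials, bounds
   omega_1 first. Conversely, the bounds on both moduli give a line close to g
   around each point x at the scale sqrt (x (1 - x) / m), and the second moment of
   the Bernstein operator finishes. *)

Require Import Defs.
From HB Require Import structures.
From mathcomp Require Import all_boot all_order all_algebra.
From mathcomp Require Import all_classical all_reals all_analysis.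
From mathcomp Require Import polyrcf ring lra zify.
Import Order.TTheory GRing.Theory Num.Theory.
Import numFieldNormedType.Exports.

Local Open Scope classical_set_scope.
Local Open Scope ring_scope.

Set Implicit Arguments.
Unset Strict Implicit.
Unset Printing Implicit Defensive.

(* De Casteljau's recursion: every identity below is an induction on [n], and
   [bernE] gives the usual form [sum_k b_k C(n, k) X^k (1 - X)^(n - k)]. *)
Fixpoint bern {R : comNzRingType} (n : nat) (b : nat -> R) : {poly R} :=
  if n is m.+1 then (1 - 'X) * bern m b + 'X * bern m (fun k => b k.+1)
  else (b 0%N)%:P.

Definition fdiff {V : zmodType} (b : nat -> V) : nat -> V :=
  fun k => b k.+1 - b k.

(** * Algebra of polynomials in Bernstein form *)

Section BernsteinAlgebra.
Context {R : comNzRingType}.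
Implicit Types (a b : nat -> R) (n k : nat) (x : R).

Lemma bernS n b :
  bern n.+1 b = (1 - 'X) * bern n b + 'X * bern n (fun k => b k.+1).
Proof. by []. Qed.

Lemma eq_bern n a b : (forall k, (k <= n)%N -> a k = b k) -> bern n a = bern n b.
Proof.
elim: n a b => [|n IH] a b ab; first by rewrite /= ab.
rewrite !bernS; congr (_ * _ + _ * _); apply: IH => k kn; apply: ab => //.
exact: leqW.
Qed.

Lemma bernD n a b : bern n (fun k => a k + b k) = bern n a + bern n b.
Proof.
elim: n a b => [|n IH] a b; first by rewrite /= polyCD.
by rewrite !bernS IH (IH (fun k => a k.+1)); ring.
Qed.

Lemma bernZ n (c : R) b : bern n (fun k => c * b k) = c%:P * bern n b.
Proof.
elim: n b => [|n IH] b; first by rewrite /= polyCM.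
by rewrite !bernS IH (IH (fun k => b k.+1)); ring.
Qed.

Lemma bernB n a b : bern n (fun k => a k - b k) = bern n a - bern n b.
Proof.
rewrite (@eq_bern _ _ (fun k => a k + -1 * b k)); last by move=> k _; ring.
by rewrite bernD bernZ polyCN polyC1 mulN1r.
Qed.

Lemma bern_const n (c : R) : bern n (fun=> c) = c%:P.
Proof. by elim: n => // n IH; rewrite bernS IH; ring. Qed.

Lemma bern_id n : bern n (fun k => k%:R) = n%:R%:P * 'X :> {poly R}.
Proof.
elim: n => [|n IH]; first by rewrite /= mul0r.
rewrite bernS (@eq_bern _ (fun k => k.+1%:R) (fun k => k%:R + 1)); last first.
  by move=> k _; rewrite -addn1 natrD.
by rewrite bernD bern_const IH -addn1 natrD polyCD; ring.
Qed.

Lemma bern_sqr n :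
  bern n (fun k => k%:R ^+ 2) = (n%:R%:P * 'X) ^+ 2 + n%:R%:P * 'X * (1 - 'X)
  :> {poly R}.
Proof.
elim: n => [|n IH]; first by rewrite /= expr0n /= polyC0; ring.
rewrite bernS (@eq_bern _ (fun k => k.+1%:R ^+ 2)
  (fun k => k%:R ^+ 2 + (2 * k%:R + 1))); last first.
  by move=> k _; rewrite -addn1 natrD; ring.
rewrite bernD IH bernD bernZ bern_const bern_id -addn1 natrD !polyCD; ring.
Qed.

Lemma bernE n b :
  bern n b = \sum_(k < n.+1) (b k * 'C(n, k)%:R)%:P * 'X^k * (1 - 'X) ^+ (n - k).
Proof.
elim: n b => [|n IH] b; first by rewrite big_ord1 /= bin0 subn0 !expr0 !mulr1.
rewrite bernS !IH [RHS]big_ord_recl /= !mulr_sumr.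
have -> : (\sum_(i < n.+1) (b (bump 0 i) * 'C(n.+1, bump 0 i)%:R)%:P * 'X^(bump 0 i)
    * (1 - 'X) ^+ (n.+1 - bump 0 i) : {poly R}) =
  \sum_(i < n.+1) (b i.+1 * 'C(n, i.+1)%:R)%:P * 'X^(i.+1) * (1 - 'X) ^+ (n - i) +
  \sum_(i < n.+1) 'X * ((b i.+1 * 'C(n, i)%:R)%:P * 'X^i * (1 - 'X) ^+ (n - i)).
  rewrite -big_split; apply: eq_bigr => i _ /=.
  by rewrite /bump leq0n add1n binS natrD subSS exprS mulrDr polyCD; ring.
rewrite addrA; congr (_ + _).
rewrite big_ord_recl big_ord_recr /= (bin_small (ltnSn n)) mulr0 polyC0 !mul0r addr0.
rewrite !bin0 !subn0 exprS; congr (_ + _); first by ring.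
apply: eq_bigr => i _; rewrite /bump leq0n add1n -(subnSK (ltn_ord i)) !exprS.
by ring.
Qed.

Lemma deriv_bern n b : (bern n.+1 b)^`() = n.+1%:R%:P * bern n (fdiff b).
Proof.
elim: n b => [|n IH] b.
  by rewrite /= /fdiff !poly.derivE polyCB; ring.
have D : bern n.+1 (fdiff b) = bern n.+1 (fun k => b k.+1) - bern n.+1 b.
  exact: bernB.
rewrite (bernS n.+1 b) derivD !derivM !IH derivB derivX -polyC1 derivC polyC1.
rewrite -(addn1 n.+1) natrD polyCD [RHS]mulrDl [X in _ = _ + X]mul1r [X in _ = _ + X]D.
by rewrite (bernS n (fdiff b)) -[fun k => fdiff b k.+1]/(fdiff (fun k => b k.+1)); ring.
Qed.

Lemma derivn_bern s n b : (s <= n)%N ->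
  (bern n b)^`(s) = (n ^_ s)%:R%:P * bern (n - s) (iter s fdiff b).
Proof.
elim: s n b => [|s IH] n b sn; first by rewrite ffactn0 subn0 mul1r.
case: n sn => // n sn.
rewrite derivSn deriv_bern mul_polyC derivnZ IH //.
by rewrite -mul_polyC mulrA -polyCM -natrM ffactSS subSS -iterSr.
Qed.

(** On the basis polynomial of index [k], the operator [x (1 - x) d/dx] is multiplication by
    [k - n x]. Applied twice, it expresses the second derivative through moments of the
    coefficients. *)
Lemma bern_mulnat n b :
  'X * (1 - 'X) * (bern n b)^`()
  = bern n (fun k => k%:R * b k) - n%:R%:P * 'X * bern n b.
Proof.
elim: n b => [|n IH] b; first by rewrite /= derivC !mul0r polyC0 mulr0 subr0.
rewrite !(bernS n) derivD !derivM derivB derivX -polyC1 derivC polyC1.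
have -> : 'X * (1 - 'X) *
   ((0 - 1) * bern n b + (1 - 'X) * (bern n b)^`() +
    (1 * bern n (fun k => b k.+1) + 'X * (bern n (fun k => b k.+1))^`())) =
   'X * (1 - 'X) * (bern n (fun k => b k.+1) - bern n b)
   + (1 - 'X) * ('X * (1 - 'X) * (bern n b)^`())
   + 'X * ('X * (1 - 'X) * (bern n (fun k => b k.+1))^`()) by ring.
rewrite !IH (@eq_bern _ (fun k => k.+1%:R * b k.+1)
  (fun k => k%:R * b k.+1 + b k.+1)); last first.
  by move=> k _; rewrite -addn1 natrD; ring.
by rewrite bernD -addn1 natrD polyCD; ring.
Qed.

(** Degree elevation, from [(n + 1) C(n, k - 1) = k C(n + 1, k)]. At [k = 0] the value [a 0] taken
    by [a k.-1] has weight 0. *)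
Lemma bern_mulX n a :
  n.+1%:R%:P * 'X * bern n a = bern n.+1 (fun k => k%:R * a k.-1).
Proof.
elim: n a => [|n IH] a; first by rewrite /= !mul0r mul1r polyC0; ring.
rewrite [RHS]bernS -IH.
rewrite (@eq_bern _ (fun k => k.+1%:R * a k.+1.-1) (fun k => k%:R * a k.-1.+1 + a k));
  last first.
  case=> [|k] _ /=.
  by rewrite mul0r add0r mul1r.
  by rewrite -(addn1 k.+1) natrD; ring.
rewrite bernD -(IH (fun k => a k.+1)) -(addn1 n.+1) natrD polyCD (bernS n a). ring.
Qed.

Lemma bern_mul1X n a :
  n.+1%:R%:P * (1 - 'X) * bern n a = bern n.+1 (fun k => (n.+1%:R - k%:R) * a k).
Proof.
elim: n a => [|n IH] a; first by rewrite /= subr0 subrr !mul0r polyC0 !mul1r; ring.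
rewrite [RHS]bernS.
rewrite (@eq_bern _ (fun k => (n.+2%:R - k.+1%:R) * a k.+1)
  (fun k => (n.+1%:R - k%:R) * a k.+1)); last first.
  by move=> k _; rewrite -(addn1 n.+1) -(addn1 k) !natrD; ring.
rewrite (@eq_bern _ (fun k => (n.+2%:R - k%:R) * a k)
  (fun k => (n.+1%:R - k%:R) * a k + a k)); last first.
  by move=> k _; rewrite -(addn1 n.+1) !natrD; ring.
by rewrite bernD -!IH -(addn1 n.+1) natrD polyCD (bernS n a); ring.
Qed.

(** Absorbs the weight [x (1 - x)] of a second derivative into the coefficients, for a bound uniform
    up to the endpoints. *)
Lemma bern_mulX1X n a :
  (n.+1 * n.+2)%:R%:P * ('X * (1 - 'X)) * bern n a
  = bern n.+2 (fun k => k%:R * (n.+2%:R - k%:R) * a k.-1).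
Proof.
rewrite [RHS](@eq_bern _ _ (fun k => (n.+2%:R - k%:R) * (k%:R * a k.-1))); last first.
  by move=> k _; rewrite mulrA [_ * k%:R]mulrC.
by rewrite -bern_mul1X -bern_mulX natrM polyCM; ring.
Qed.

Lemma bern_deriv2 n b :
  ('X * (1 - 'X)) ^+ 2 * (bern n b)^`(2)
  = bern n (fun k => k%:R ^+ 2 * b k) - 2%:R%:P * n%:R%:P * 'X * bern n (fun k => k%:R * b k)
    + (n%:R%:P * 'X) ^+ 2 * bern n b
    - n%:R%:P * ('X * (1 - 'X)) * bern n b
    - (1 - 2%:R%:P * 'X) * (bern n (fun k => k%:R * b k) - n%:R%:P * 'X * bern n b).
Proof.
have E := bern_mulnat n b.
have E2 := bern_mulnat n (fun k => k%:R * b k).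
rewrite (@eq_bern _ (fun k => k%:R ^+ 2 * b k) (fun k => k%:R * (k%:R * b k)));
  last by move=> k _; ring.
have -> : bern n (fun k => k%:R * (k%:R * b k)) =
  'X * (1 - 'X) * (bern n (fun k => k%:R * b k))^`() +
  n%:R%:P * 'X * bern n (fun k => k%:R * b k) by rewrite E2; ring.
have E3 : bern n (fun k => k%:R * b k) =
   'X * (1 - 'X) * (bern n b)^`() + n%:R%:P * 'X * bern n b by rewrite E; ring.
rewrite E3 !(derivB, derivD, derivM, derivX, derivC) !derivnS derivn0.
ring.
Qed.

End BernsteinAlgebra.

(** * Bernstein-type inequalities *)

Section BernsteinOrder.
Context {R : realFieldType}.
Implicit Types (a b : nat -> R) (n k : nat) (x : R).

Lemma bern_ge0 n b x : 0 <= x <= 1 ->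
  (forall k, (k <= n)%N -> 0 <= b k) -> 0 <= (bern n b).[x].
Proof.
move=> /andP[x0 x1]; elim: n b => [|n IH] b b0; first by rewrite hornerC b0.
rewrite bernS !hornerE addr_ge0 // mulr_ge0 ?subr_ge0 // IH // => k kn.
  exact/b0/leqW.
exact: b0.
Qed.

Lemma ler_bern n a b x : 0 <= x <= 1 ->
  (forall k, (k <= n)%N -> a k <= b k) -> (bern n a).[x] <= (bern n b).[x].
Proof.
move=> x01 ab; rewrite -subr_ge0 -hornerN -hornerD -bernB bern_ge0 // => k kn.
by rewrite subr_ge0 ab.
Qed.

Lemma ler_norm_bern n a b x : 0 <= x <= 1 ->
  (forall k, (k <= n)%N -> `|a k| <= b k) -> `|(bern n a).[x]| <= (bern n b).[x].
Proof.
move=> x01 ab; rewrite ler_norml; apply/andP; split; last first.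
  by apply: ler_bern => // k /ab; rewrite ler_norml => /andP[].
rewrite -subr_ge0 opprK -hornerD -bernD bern_ge0 // => k /ab.
by rewrite ler_norml -subr_ge0 opprK => /andP[].
Qed.

Lemma norm_bern_le n a x (c : R) : 0 <= x <= 1 ->
  (forall k, (k <= n)%N -> `|a k| <= c) -> `|(bern n a).[x]| <= c.
Proof.
by move=> x01 ac; rewrite -[leRHS](hornerC c x) -(bern_const n c) ler_norm_bern.
Qed.

Lemma bern_lin n x (c d : R) :
  (bern n (fun k => c * k%:R + d)).[x] = c * (n%:R * x) + d.
Proof. by rewrite bernD bernZ bern_id bern_const !hornerE. Qed.

Lemma bern_var n x :
  (bern n (fun k => (k%:R - n%:R * x) ^+ 2)).[x] = n%:R * (x * (1 - x)).
Proof.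
rewrite (@eq_bern _ _ _ (fun k => k%:R ^+ 2 +
   ((- (2 * n%:R * x)) * k%:R + (n%:R * x) ^+ 2))); last by move=> k _; ring.
rewrite bernD hornerD bern_lin bern_sqr !hornerE /=; ring.
Qed.

(** Recentring at the binomial mean [n x] leaves a weight quadratic in [k - n x], whose size
    [bern_var] controls. *)
Lemma bern_deriv2_horner n b x :
  (x * (1 - x)) ^+ 2 * (bern n b)^`(2).[x]
  = (bern n (fun k => ((k%:R - n%:R * x) ^+ 2 - n%:R * (x * (1 - x))
                       - (1 - 2 * x) * (k%:R - n%:R * x)) * b k)).[x].
Proof.
have := congr1 (horner^~ x) (bern_deriv2 n b); rewrite !hornerE /= => ->.
rewrite (@eq_bern _ _ (fun k => (_ - _ - _) * _)
   (fun k => k%:R ^+ 2 * b k + ((- (2 * n%:R * x) - (1 - 2 * x)) * (k%:R * b k) +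
   ((n%:R * x) ^+ 2 - n%:R * (x * (1 - x)) + (1 - 2 * x) * (n%:R * x)) * b k)));
  last by move=> k _; ring.
rewrite 2!bernD 2!bernZ !hornerE /=; ring.
Qed.

(* Near the endpoints [n x (1 - x) <= 1] the second difference of the
   coefficients is used, elsewhere the variance of the binomial distribution. *)
Lemma bern_deriv2_le n b x (c : R) : 0 <= x <= 1 ->
  (forall k, (k <= n.+2)%N -> `|b k| <= c) ->
  `|x * (1 - x) * (bern n.+2 b)^`(2).[x]| <= 5 * n.+2%:R * c.
Proof.
move=> x01 bc; have /andP[x0 x1] := x01.
have c0 : 0 <= c by apply: le_trans (bc 0%N isT).
set r := x * (1 - x); have r0 : 0 <= r by rewrite mulr_ge0 // subr_ge0.
set N : R := n.+2%:R; have N0 : 0 < N by rewrite ltr0n.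
case: (leP (N * r) 1) => Nr.
  rewrite derivn_bern // hornerM hornerC normrM ger0_norm // normrM.
  have B : `|(bern (n.+2 - 2) (iter 2 fdiff b)).[x]| <= 4 * c.
    apply: norm_bern_le => // k; rewrite subSS subSS subn0 => kn /=.
    rewrite /fdiff; apply: le_trans (ler_normB _ _) _.
    have := ler_normB (b k.+2) (b k.+1); have := ler_normB (b k.+1) (b k).
    have := bc k.+2 kn; have := bc k.+1 (leqW kn); have := bc k (leqW (leqW kn)).
    move: `|_ - _| `|_ - _| `|b _| `|b _| `|b _| => *; lra.
  rewrite ger0_norm ?ler0n //.
  have F : (n.+2 ^_ 2)%:R <= N * N.
    by rewrite -natrM ler_nat ffactnS ffactn1 leq_mul.
  have : r * ((n.+2 ^_ 2)%:R * (4 * c)) <= 4 * N * c.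
    have -> : 4 * N * c = N * 1 * (4 * c) by ring.
    rewrite mulrA ler_wpM2r ?mulr_ge0 //.
    apply: (@le_trans _ _ (r * (N * N))); first by rewrite ler_wpM2l.
    by rewrite mulrCA ler_wpM2l ?(ltW N0) // mulrC.
  have : 0 <= N * c by rewrite mulr_ge0 // ltW.
  have : r * ((n.+2 ^_ 2)%:R * `|(bern (n.+2 - 2) (iter 2 fdiff b)).[x]|)
     <= r * ((n.+2 ^_ 2)%:R * (4 * c)) by rewrite !ler_wpM2l.
  by move=> *; lra.
have r1 : 0 < r by rewrite -(pmulr_rgt0 _ N0); apply: lt_trans Nr.
rewrite -(ler_pM2l r1) -{1}(gtr0_norm r1) -normrM mulrA -expr2.
rewrite bern_deriv2_horner -/N -/r.
(* From [|1 - 2 x| <= 1] and [|y| <= 1 + y ^ 2] with [y = k - N x]. By the variance the mean of [w]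
   is [(3 N r + 1) c], at most [4 N r c] since [N r > 1]. *)
pose w k : R := (2 * (k%:R - N * x) ^+ 2 + (N * r + 1)) * c.
apply: (@le_trans _ _ (bern n.+2 w).[x]).
  apply: ler_norm_bern => // k kn; rewrite normrM ler_pM //.
    2: exact: bc.
  set y := _ - N * x.
  have : `|(1 - 2 * x) * y| <= 1 + y ^+ 2.
    rewrite normrM -(real_normK (num_real y)).
    have : `|1 - 2 * x| <= 1 by rewrite ler_norml; apply/andP; split; lra.
    move: (normr_ge0 y) (normr_ge0 (1 - 2 * x)); move: `|y| `|1 - 2 * x| => *; nra.
  have Nr0 : 0 <= N * r by rewrite mulr_ge0 // ltW.
  have : `|y ^+ 2 - N * r| <= y ^+ 2 + N * r.
    by rewrite ler_norml; apply/andP; split; move: (sqr_ge0 y) => ?; lra.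
  have := ler_normB (y ^+ 2 - N * r) ((1 - 2 * x) * y).
  by move: `|_ - (1 - 2 * x) * y| => *; lra.
rewrite (@eq_bern _ _ _ (fun k => (2 * c) * (k%:R - N * x) ^+ 2 + (N * r + 1) * c));
  last by move=> k _; rewrite /w; ring.
rewrite bernD bern_const bernZ hornerD hornerM !hornerC.
have -> : (bern n.+2 (fun k => (k%:R - N * x) ^+ 2)).[x] = N * r := bern_var n.+2 x.
have := ler_wpM2r c0 (ltW Nr).
rewrite mul1r => H.
have -> : r * (5 * N * c) = 5 * (N * r * c) by ring.
lra.
Qed.

End BernsteinOrder.

(** * Second differences under a bound on the weighted second derivative *)

Section SecondDifference.
Context {R : rcfType}.
Implicit Types (p : {poly R}) (x y d K : R).

(* The mean value theorem for [t |-> p(x + e t) + e (d - t) p'(x + e t)], whose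
   derivative is [(d - t) p''(x + e t)]: the factor [d - t] cancels the
   singularity of [1 / (y (1 - y))] at the endpoints. *)
Lemma taylor1_weighted p x d e K : e ^+ 2 = 1 -> 0 < x < 1 ->
  0 < d -> d <= x -> d <= 1 - x ->
  (forall y, 0 < y < 1 -> `|y * (1 - y) * p^`(2).[y]| <= K) ->
  `|p.[x + e * d] - p.[x] - e * d * p^`().[x]| <= K * d ^+ 2 / (x * (1 - x)).
Proof.
move=> e2 /andP[x0 x1] d0 dx dx1 pK.
have K0 : 0 <= K by apply: le_trans (pK x _); rewrite ?x0 ?x1.
pose th := p \Po (x%:P + e%:P * 'X) + e%:P * (d%:P - 'X) * (p^`() \Po (x%:P + e%:P * 'X)).
have [t + +] := poly_mvt th d0.
rewrite in_itv /= => /andP[t0 td].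
have E2 : e * e = 1 by rewrite -expr2.
have -> : th^`() = e%:P * e%:P * (d%:P - 'X) * (p^`(2) \Po (x%:P + e%:P * 'X)).
  rewrite /th !(derivD, derivM, deriv_comp, derivN, derivX, derivC) !derivnS derivn0.
  ring.
rewrite /th !(hornerD, hornerM, hornerN, hornerC, hornerX, horner_comp) subrr mulr0 mul0r.
rewrite !addr0 !subr0 E2 mul1r.
have -> : p.[x + e * d] - (p.[x] + e * d * p^`().[x]) =
          p.[x + e * d] - p.[x] - e * d * p^`().[x] by ring.
move=> ->; set y := x + e * t.
have ee : e = 1 \/ e = -1.
  by have /eqP := e2; rewrite sqrf_eq1 => /orP[]/eqP->; [left|right].
have y01 : 0 < y < 1 by apply/andP; rewrite /y; case: ee => ->; split; lra.
have /andP[y0 y1] := y01.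
have r0 : 0 < x * (1 - x) by rewrite mulr_gt0 // subr_gt0.
have s0 : 0 < y * (1 - y) by rewrite mulr_gt0 // subr_gt0.
have dt : 0 <= d - t by lra.
(* Concavity of [y (1 - y)] along the segment: it is nonnegative at [x + e d], hence at least
   [(1 - t / d) x (1 - x)] at parameter [t]. *)
have key : (d - t) * (x * (1 - x)) <= d * (y * (1 - y)).
  have h1 : 0 <= (x + d) * (1 - x - d) by rewrite mulr_ge0 //; lra.
  have h2 : 0 <= (x - d) * (1 - x + d) by rewrite mulr_ge0 //; lra.
  rewrite /y; case: ee => ->.
    have : 0 <= t * ((x + d) * (1 - x - d) + d * (d - t)).
      by rewrite mulr_ge0 ?(ltW t0) // addr_ge0 // mulr_ge0 // ltW.
    by move=> *; nra.
  have : 0 <= t * ((x - d) * (1 - x + d) + d * (d - t)).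
    by rewrite mulr_ge0 ?(ltW t0) // addr_ge0 // mulr_ge0 // ltW.
  by move=> *; nra.
have := pK y y01; rewrite normrM (gtr0_norm s0) => P.
rewrite ler_pdivlMr // !normrM (ger0_norm dt) (gtr0_norm d0).
set P2 := `|p^`(2).[y]|; rewrite -/P2 in P.
have P20 : 0 <= P2 := normr_ge0 _.
have h3 : (d - t) * (x * (1 - x)) * P2 <= d * (y * (1 - y)) * P2 by rewrite ler_wpM2r.
have h4 : d * (y * (1 - y) * P2) <= d * K by rewrite ler_wpM2l // ltW.
have -> : (d - t) * P2 * d * (x * (1 - x)) = d * ((d - t) * (x * (1 - x)) * P2) by ring.
have -> : K * d ^+ 2 = d * (d * K) by ring.
rewrite ler_wpM2l ?(ltW d0) //; apply: le_trans h3 (le_trans _ h4).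
by rewrite -mulrA.
Qed.

(** Adding the expansions for [e = 1] and [e = -1] cancels the first-order terms. *)
Lemma second_diff_poly p x d K : 0 < x < 1 -> 0 < d -> d <= x -> d <= 1 - x ->
  (forall y, 0 < y < 1 -> `|y * (1 - y) * p^`(2).[y]| <= K) ->
  `|p.[x + d] - p.[x] *+ 2 + p.[x - d]| <= 2 * K * d ^+ 2 / (x * (1 - x)).
Proof.
move=> x01 d0 dx dx1 pK.
have := @taylor1_weighted p x d 1 K (expr1n _ _) x01 d0 dx dx1 pK.
have := @taylor1_weighted p x d (-1) K _ x01 d0 dx dx1 pK.
rewrite sqrrN expr1n => /(_ erefl); rewrite !mulN1r !mul1r => A B.
have -> : p.[x + d] - p.[x] *+ 2 + p.[x - d] =
   (p.[x + d] - p.[x] - d * p^`().[x]) + (p.[x - d] - p.[x] - - d * p^`().[x]) by ring.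
apply: le_trans (ler_normD _ _) _.
have -> : 2 * K * d ^+ 2 / (x * (1 - x)) =
   K * d ^+ 2 / (x * (1 - x)) + K * d ^+ 2 / (x * (1 - x)) by ring.
exact: lerD.
Qed.

(** By [bern_mulX1X] the coefficients are [k (N - k)] times the second difference of [p] at [k / N]
    with step [1 / N], which [second_diff_poly] bounds by [2 K / (k (N - k))]. *)
Lemma bern_deriv2_stable p n x K : 0 <= x <= 1 ->
  (forall y, 0 < y < 1 -> `|y * (1 - y) * p^`(2).[y]| <= K) ->
  `|x * (1 - x) * (bern n.+2 (fun k => p.[k%:R / n.+2%:R]))^`(2).[x]| <= 2 * K.
Proof.
move=> x01 pK.
have K0 : 0 <= K.
  by apply: le_trans (pK 2^-1 _) => //; apply/andP; split; lra.
set N : R := n.+2%:R; have N0 : 0 < N by rewrite ltr0n.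
rewrite derivn_bern // !subSS subn0 hornerM hornerC.
set a := iter 2 fdiff _.
have -> : x * (1 - x) * ((n.+2 ^_ 2)%:R * (bern n a).[x]) =
   ((n.+1 * n.+2)%:R%:P * ('X * (1 - 'X)) * bern n a).[x].
  rewrite !(hornerD, hornerM, hornerN, hornerC, hornerX) ffactnS ffactn1 mulnC natrM.
  by rewrite mulrCA mulrA.
rewrite bern_mulX1X; apply: norm_bern_le => // k kn.
(* The weight [k (N - k)] vanishes at both ends, where the second difference would leave
   [[0, 1]]. *)
case: k kn => [|k] kn; first by rewrite !mul0r normr0 mulr_ge0.
have [->|kn1] := eqVneq k n.+1; first by rewrite subrr mulr0 mul0r normr0 mulr_ge0.
have {kn kn1} kn : (k <= n)%N by rewrite -ltnS ltn_neqAle kn1 -ltnS.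
have kN : k.+1%:R < N by rewrite ltr_nat; lia.
have k0 : 0 < k.+1%:R :> R by rewrite ltr0n.
have k1N : k.+1%:R + 1 <= N by rewrite natr1 ler_nat !ltnS.
have k1 : 1 <= k.+1%:R :> R by rewrite ler1n.
have e1 : 1 - k.+1%:R / N = (N - k.+1%:R) / N by rewrite mulrBl divff ?gt_eqF.
have s0 : 0 < N - k.+1%:R by rewrite subr_gt0.
have yN : N^-1 <= k.+1%:R / N by rewrite ler_pdivlMr // mulVf ?gt_eqF.
have y1N : N^-1 <= 1 - k.+1%:R / N by rewrite e1 ler_pdivlMr // mulVf ?gt_eqF; lra.
have y01 : 0 < k.+1%:R / N < 1 by rewrite divr_gt0 //= ltr_pdivrMr // mul1r.
have Ni0 : 0 < N^-1 by rewrite invr_gt0.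
have := @second_diff_poly p _ _ K y01 Ni0 yN y1N pK; rewrite e1.
have -> : k.+1%:R / N + N^-1 = k.+2%:R / N by rewrite -(natr1 k.+1) mulrDl mul1r.
have -> : k.+1%:R / N - N^-1 = k%:R / N by rewrite -(natr1 k) mulrDl mul1r addrK.
rewrite ler_pdivlMr; last by rewrite mulr_gt0 // divr_gt0.
have -> : a k.+1.-1 = p.[k.+2%:R / N] - p.[k.+1%:R / N] *+ 2 + p.[k%:R / N].
  rewrite /a /= /fdiff -/N; move: p.[k.+2%:R / N] p.[k.+1%:R / N] p.[k%:R / N].
  by move=> A B C; ring.
rewrite normrM (gtr0_norm (mulr_gt0 k0 s0)); set D := `|_| => H.
rewrite -(ler_pM2r (exprn_gt0 2 Ni0)); apply: le_trans H; rewrite le_eqVlt.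
apply/orP; left; apply/eqP. ring.
Qed.

End SecondDifference.

(** * The direct estimate *)

Section LocalLinear.
Context {R : realType}.
Implicit Types (S : R -> R) (u v d e B : R).

(** Let [M = sup |S|], finite thanks to [B]. The second difference at [u] with one outer point at
    the nearer end, where [S] vanishes, gives [2 |S u| <= M + e]; hence [M <= (M + e) / 2], so
    [M <= e]. *)
Lemma second_diff_vanish S d e B : 0 < d -> S 0 = 0 -> S d = 0 ->
  (forall u, 0 <= u <= d -> `|S u| <= B) ->
  (forall u v, 0 <= v -> 0 <= u - v -> u + v <= d ->
     `|S (u + v) - S u *+ 2 + S (u - v)| <= e) ->
  forall u, 0 <= u <= d -> `|S u| <= e.
Proof.
move=> d0 S0 Sd SB Se.
pose E := [set `|S u| | u in [set u | 0 <= u <= d]].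
have hE : has_sup E.
  split; first by exists `|S 0|; exists 0 => //=; rewrite lexx ltW.
  by exists B => _ [u /= ud <-]; exact: SB.
have SE u : 0 <= u <= d -> `|S u| <= sup E.
  by move=> ud; apply: (ub_le_sup hE.2); exists u.
have half u : 0 <= u <= d -> `|S u| <= (sup E + e) / 2.
  move=> /andP[u0 ud]; have [ud2|ud2] := leP (u + u) d.
    have := Se u u u0; rewrite subrr lexx => /(_ isT ud2).
    rewrite S0 addr0 => H; have /SE : 0 <= u + u <= d by rewrite ud2 addr_ge0.
    move: H; move: (S u) (S (u + u)) => s t.
    have := ler_normB t (t - s *+ 2).
    have -> : t - (t - s *+ 2) = s *+ 2 by ring.
    by rewrite normrMn => *; lra.
  have ud3 : 0 <= d - u by rewrite subr_ge0.
  have := Se u (d - u) ud3.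
  have -> : u + (d - u) = d by ring.
  have -> : u - (d - u) = u + u - d by ring.
  rewrite subr_ge0 lexx ltW // Sd add0r => /(_ isT isT) H.
  have /SE : 0 <= u + u - d <= d. apply/andP; split; lra.
  move: H; move: (S u) (S (u + u - d)) => s t.
  have := ler_normB t (- (s *+ 2) + t).
  have -> : t - (- (s *+ 2) + t) = s *+ 2 by ring.
  by rewrite normrMn => *; lra.
have : sup E <= (sup E + e) / 2.
  by apply: ge_sup hE.1 _ => _ [u /= ud <-]; exact: half.
by move=> ? u /half ?; lra.
Qed.

(* Up to [d] the interpolating line is good by [second_diff_vanish]; beyond, the
   error [T(u)] satisfies [T(u) = 2 T(u / 2) + O(e (u / d)^2)]. *)
Lemma local_linear S d e B rho : 0 < d -> d <= rho -> 0 <= e -> S 0 = 0 ->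
  (forall u, 0 <= u <= d -> `|S u| <= B) ->
  (forall u v, 0 <= v -> - rho <= u - v -> u + v <= rho ->
     `|S (u + v) - S u *+ 2 + S (u - v)| <= e * (1 + (v / d) ^+ 2)) ->
  forall u, `|u| <= rho -> `|S u - u / d * S d| <= 6 * e * (1 + (u / d) ^+ 2).
Proof.
move=> d0 drho e0 S0 SB Se.
pose T u := S u - u / d * S d.
have rho0 : 0 < rho by apply: lt_le_trans drho.
have TE u v : T (u + v) - T u *+ 2 + T (u - v) = S (u + v) - S u *+ 2 + S (u - v).
  by rewrite /T; field; rewrite gt_eqF.
have T0 : T 0 = 0 by rewrite /T S0 !mul0r subrr.
have Td : T d = 0 by rewrite /T divff ?gt_eqF // mul1r subrr.
have small u : 0 <= u <= d -> `|T u| <= 5 / 4 * e.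
  apply: (@second_diff_vanish T d _ (B + B)) => // {u}.
    move=> u ud; apply: le_trans (ler_normB _ _) _; rewrite lerD ?SB // normrM.
    have ud1 : `|u / d| <= 1.
      by case/andP: ud => u0 ud; rewrite ger0_norm ?divr_ge0 ?(ltW d0) // ler_pdivrMr // mul1r.
    apply: le_trans (SB d _); last by rewrite lexx ltW.
    by rewrite -[leRHS]mul1r ler_wpM2r.
  move=> u v v0 uv uvd; rewrite TE; apply: le_trans (Se u v v0 _ _) _; try lra.
  rewrite [leRHS]mulrC ler_wpM2l //.
  have /andP[? ?] : 0 <= v / d <= 2^-1.
    by rewrite divr_ge0 ?(ltW d0) //= ler_pdivrMr //; lra.
  by nra.
(* The base case is [small], since [(u / d) ^ 2 >= 1 / 4]. For [r = u / d >= 1], halving gives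
   [2 * 5 / 4 * e r ^ 2 + e (1 + r ^ 2 / 4)], at most [15 / 4 * e r ^ 2]. *)
have large k u : d / 2 <= u -> u <= 2 ^+ k * d -> u <= rho ->
    `|T u| <= 5 * e * (u / d) ^+ 2.
  elim: k u => [|k IH] u du ukd ur.
    rewrite expr0 mul1r in ukd.
    apply: le_trans (small u _) _; first by apply/andP; split; lra.
    have : 2^-1 * 2^-1 <= (u / d) * (u / d) by rewrite ler_pM // ler_pdivlMr // mulrC.
    move=> /(ler_wpM2l e0); rewrite -expr2 => ?; lra.
  have [ud|ud] := leP u d; first by apply: IH => //; apply: le_trans ud _;
    rewrite ler_peMl ?(ltW d0) // exprn_ege1 // ler1n.
  have {}IH := IH (u / 2) _ _ _.
  have := TE (u / 2) (u / 2); rewrite subrr T0 addr0.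
  have -> : u / 2 + u / 2 = u by field.
  move=> E.
  have := Se (u / 2) (u / 2); rewrite -TE subrr T0 addr0.
  have -> : u / 2 + u / 2 = u by field.
  move=> /(_ _ _ ur) H.
  have {}H : `|T u - T (u / 2) *+ 2| <= e * (1 + (u / 2 / d) ^+ 2).
    by apply: H; lra.
  have {}IH : `|T (u / 2)| <= 5 * e * (u / 2 / d) ^+ 2.
    by apply: IH; [lra| rewrite exprS in ukd; lra |lra].
  have E2 : u / 2 / d = u / d / 2 by rewrite mulrAC.
  have r1 : 1 <= u / d by rewrite ler_pdivlMr // mul1r ltW.
  rewrite E2 in IH H; move: r1 IH H; set r := u / d => r1 IH H.
  have : `|T u| <= `|T u - T (u / 2) *+ 2| + `|T (u / 2)| *+ 2.
    by rewrite -normrMn; apply: le_trans (ler_normD _ _); rewrite subrK.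
  have : e * 1 <= e * r ^+ 2 by rewrite ler_wpM2l // exprn_ege1.
  by move=> *; nra.
have pos u : 0 <= u <= rho -> `|T u| <= 5 * e * (1 + (u / d) ^+ 2).
  move=> /andP[u0 ur]; have er : 0 <= e * (u / d) ^+ 2 by rewrite mulr_ge0 ?sqr_ge0.
  have [ud|ud] := leP u d.
    by have := small u; rewrite u0 ud => /(_ isT) ?; lra.
  have [k ku] : exists k, u <= 2 ^+ k * d.
    exists (Num.truncn (u / d)).+1; rewrite -ler_pdivrMr //.
    apply: (@le_trans _ _ (Num.truncn (u / d)).+1%:R).
      by rewrite ltW // truncnS_gt.
    by rewrite -natrX ler_nat ltnW // ltn_expl.
  by have := large k u _ ku ur => H; have := H _; lra.
move=> u; rewrite ler_norml -/(T u) => /andP[ur1 ur2].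
have [u0|u0] := leP 0 u.
  have er : 0 <= e * (1 + (u / d) ^+ 2) by rewrite mulr_ge0 // addr_ge0 ?sqr_ge0.
  by have := pos u; rewrite u0 ur2 => /(_ isT) ?; lra.
(* For [u < 0], the second difference centred at 0 compares [T u] with [- T (- u)] and raises the
   constant from 5 to 6. *)
have := pos (- u); rewrite oppr_ge0 ltW // lerNl ur1 => /(_ isT) P.
have := Se 0 (- u); rewrite -TE T0 mul0rn subr0 opprK !add0r => /(_ _ _ _) Q.
have {}Q : `|T (- u) + T u| <= e * (1 + (- u / d) ^+ 2) by apply: Q; lra.
have : `|T u| <= `|T (- u) + T u| + `|T (- u)|.
  by apply: le_trans (ler_normB _ _); rewrite addrC addKr.
by rewrite mulNr sqrrN in P Q; lra.
Qed.

End LocalLinear.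

Section DirectTheorem.
Context {R : realType}.
Implicit Types (g : R -> R) (al M x u y e lam dl : R) (n : nat).

Lemma powR_le1D al u : 0 <= al <= 1 -> 0 <= u -> u `^ al <= 1 + u.
Proof.
move=> /andP[al0 al1] u0; have [u1|u1] := leP u 1.
  apply: (@le_trans _ _ (1 `^ al)); last by rewrite powR1 lerDl.
  by rewrite ge0_ler_powR // nnegrE.
by apply: (@le_trans _ _ u); rewrite ?lerDr // ler1_powR // ltW.
Qed.

(** Factors out the rate [n ^ (- al)]; the rest is a power of [n u], which [powR_le1D] bounds by
    [1 + n u]. *)
Lemma powR_scale al n u : (0 < n)%N -> 0 <= u ->
  u `^ al = n%:R `^ (- al) * (n%:R * u) `^ al.
Proof.
move=> n0 u0; rewrite powRM // mulrA -powRD; last by rewrite addNr eqxx pnatr_eq0 -lt0n.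
by rewrite addNr powRr0 mul1r.
Qed.

Lemma bern_node_var n x : (0 < n)%N ->
  (bern n (fun k => (k%:R / n%:R - x) ^+ 2)).[x] = x * (1 - x) / n%:R.
Proof.
move=> n0; have nn0 : n%:R != 0 :> R by rewrite pnatr_eq0 -lt0n.
rewrite (@eq_bern _ _ _ (fun k => n%:R ^- 2 * (k%:R - n%:R * x) ^+ 2)); last first.
  by move=> k _; field.
by rewrite bernZ hornerM hornerC bern_var; field.
Qed.

Lemma bern_node_lin n x (c d : R) : (0 < n)%N ->
  (bern n (fun k => c + d * (k%:R / n%:R - x))).[x] = c.
Proof.
move=> n0; have nn0 : n%:R != 0 :> R by rewrite pnatr_eq0 -lt0n.
rewrite (@eq_bern _ _ _ (fun k => d / n%:R * k%:R + (c - d * x))); last first.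
  by move=> k _; field.
by rewrite bern_lin; field.
Qed.

Lemma node01 n k : (k <= n)%N -> 0 <= (k%:R / n%:R : R) <= 1.
Proof.
move=> kn; rewrite divr_ge0 //=; case: n kn => [|n] kn; first by rewrite invr0 mulr0.
by rewrite ler_pdivrMr ?ltr0n // mul1r ler_nat.
Qed.

(** The Bernstein operator reproduces the line [g x + lam (t - x)] and sends [(t - x) ^ 2] to
    [x (1 - x) / n] at [x]. *)
Lemma bern_local g n x lam e dl : (0 < n)%N -> 0 <= x <= 1 -> 0 < dl ->
  (forall t, 0 <= t <= 1 ->
     `|g t - g x - lam * (t - x)| <= e * (1 + (t - x) ^+ 2 / dl)) ->
  `|(bern n (fun k => g (k%:R / n%:R))).[x] - g x|
     <= e * (1 + x * (1 - x) / n%:R / dl).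
Proof.
move=> n0 x01 dl0 H; have N0 : 0 < n%:R :> R by rewrite ltr0n.
rewrite -(@bern_node_lin n x (g x) lam n0) -hornerN -hornerD -bernB.
have -> : e * (1 + x * (1 - x) / n%:R / dl) =
    (bern n (fun k => e + e / dl * (k%:R / n%:R - x) ^+ 2)).[x].
  rewrite bernD bern_const bernZ hornerD hornerM !hornerC bern_node_var //.
  by field; rewrite !gt_eqF.
apply: ler_norm_bern => // k kn; rewrite opprD addrA.
apply: le_trans (H _ (node01 kn)) _; rewrite le_eqVlt; apply/orP; left; apply/eqP.
by field; rewrite !gt_eqF.
Qed.

(* For [n x (1 - x) <= 4] the Hölder condition suffices. Otherwise [g] is
   compared with the chord over [[x, x + d]], [d ^+ 2 = x (1 - x) / n]: at
   distance at most [x (1 - x) / 2] from [x] by [local_linear], farther by the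
   Hölder condition. *)
Lemma bern_direct g al M n x : 0 < al <= 1 -> 0 <= M ->
  (forall x y, 0 <= x <= 1 -> 0 <= y <= 1 -> `|g x - g y| <= M * `|x - y| `^ al) ->
  (forall y u, 0 < y < 1 -> 0 <= u -> 0 <= y - u -> y + u <= 1 ->
    `|g (y + u) - g y *+ 2 + g (y - u)| <= M * (u ^+ 2 / (y * (1 - y))) `^ al) ->
  (0 < n)%N -> 0 <= x <= 1 ->
  `|(bern n (fun k => g (k%:R / n%:R))).[x] - g x| <= 24 * M * n%:R `^ (- al).
Proof.
move=> /andP[al0 al1] M0 gH gZ n0 x01; have al01 : 0 <= al <= 1 by rewrite ltW.
have /andP[x0 x1] := x01.
set N : R := n%:R; have N0 : 0 < N by rewrite ltr0n.
set eps := N `^ (- al); have eps0 : 0 <= eps by exact: powR_ge0.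
have scale u : 0 <= u -> u `^ al <= eps * (1 + N * u).
  move=> u0; rewrite (powR_scale al n0 u0) ler_wpM2l // powR_le1D // mulr_ge0 // ltW.
have Me : 0 <= M * eps by rewrite mulr_ge0.
set r := x * (1 - x).
case: (leP (N * r) 4) => Nr.
  have := @bern_local g n x 0 (2 * M * eps) (N ^- 2) n0 x01.
  rewrite invr_gt0 exprn_gt0 // -/N -/r => /(_ isT) H.
  have {H} : `|(bern n (fun k => g (k%:R / N))).[x] - g x| <=
     2 * M * eps * (1 + r / N / N ^- 2).
    apply: H => t t01; rewrite mul0r subr0.
    apply: le_trans (gH _ _ t01 x01) _.
    have -> : 2 * M * eps * (1 + (t - x) ^+ 2 / N ^- 2) =
       M * (eps * (2 * (1 + (N * `|t - x|) ^+ 2))).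
      by rewrite exprMn real_normK ?num_real // invrK; ring.
    rewrite ler_wpM2l //; apply: le_trans (scale _ (normr_ge0 _)) _.
    rewrite ler_wpM2l //; set q := N * _.
    by have := sqr_ge0 (q - 1); rewrite sqrrB1 expr2 => *; nra.
  move/le_trans; apply.
  have -> : r / N / N ^- 2 = N * r by field; rewrite gt_eqF.
  have : M * eps * (N * r) <= M * eps * 4 by rewrite ler_wpM2l.
  by move=> *; lra.
have r0 : 0 < r by rewrite -(pmulr_rgt0 _ N0); apply: lt_trans Nr.
set d := Num.sqrt (r / N).
have d0 : 0 < d by rewrite sqrtr_gt0 divr_gt0.
have d2 : d ^+ 2 = r / N by rewrite sqr_sqrtr // ltW // divr_gt0.
have Nd2 : N * d ^+ 2 = r by rewrite d2; field; rewrite gt_eqF.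
(* This is where the threshold 4 for [N r] comes from: the local interval of radius [r / 2] must
   contain [x + d]. *)
have dr : d <= r / 2.
  rewrite -(@ler_pXn2r _ 2) ?nnegrE ?divr_ge0 ?(ltW d0) ?(ltW r0) // d2 ler_pdivrMr //.
  by rewrite -{1}[r]mulr1; have := ler_wpM2l (ltW r0) (ltW Nr); nra.
have Nd : 1 <= N * d.
  rewrite -(@ler_pXn2r _ 2) ?nnegrE ?mulr_ge0 ?(ltW d0) ?(ltW N0) // expr1n exprMn d2.
  have -> : N ^+ 2 * (r / N) = N * r by field; rewrite gt_eqF.
  by lra.
have rx : r <= x by rewrite /r; nra.
have rx1 : r <= 1 - x by rewrite /r; nra.
pose S u := g (x + u) - g x.
have xu01 u : `|u| <= r / 2 -> 0 <= x + u <= 1.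
  by rewrite ler_norml => /andP[? ?]; apply/andP; split; lra.
have loc u : `|u| <= r / 2 -> `|S u - u / d * S d| <= 12 * (M * eps) * (1 + (u / d) ^+ 2).
  have -> : 12 * (M * eps) = 6 * (2 * M * eps) by ring.
  apply: (@local_linear _ S d _ M) => //; first by rewrite mulr_ge0 // mulr_ge0.
    by rewrite /S addr0 subrr.
    move=> v /andP[v0 vd]; have v1 : `|v| <= r / 2 by rewrite ger0_norm //; lra.
    apply: le_trans (gH _ _ (xu01 _ v1) x01) _.
    have -> : x + v - x = v by ring.
    rewrite -[leRHS]mulr1 ler_wpM2l //; apply: (@le_trans _ _ (1 `^ al)); last by rewrite powR1.
    by rewrite ge0_ler_powR ?nnegrE ?(ltW al0) //; lra.
  move=> {}u v v0 uv1 uv2; rewrite /S.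
  have -> : g (x + (u + v)) - g x - (g (x + u) - g x) *+ 2 + (g (x + (u - v)) - g x) =
     g (x + u + v) - g (x + u) *+ 2 + g (x + u - v) by rewrite !addrA; ring.
  have u1 : `|u| <= r / 2 by rewrite ler_norml; apply/andP; split; lra.
  (* [y (1 - y)] has slope at most 1 on [[0, 1]], so it keeps half of its value [r] over a distance
     [r / 2]. *)
  have ry : r / 2 <= (x + u) * (1 - (x + u)).
    have : `|u * (1 - 2 * x - u)| <= r / 2.
      rewrite normrM -[leRHS]mulr1 ler_pM // ler_norml.
      by move: u1; rewrite ler_norml => /andP[? ?]; apply/andP; split; lra.
    by rewrite ler_norml /r => /andP[? ?]; lra.
  have y01 : 0 < x + u < 1 by apply/andP; split; lra.
  apply: le_trans (gZ _ _ y01 v0 _ _) _; [lra|lra|].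
  have -> : 2 * M * eps * (1 + (v / d) ^+ 2) = M * (eps * (2 * (1 + (v / d) ^+ 2))) by ring.
  rewrite ler_wpM2l //.
  apply: (@le_trans _ _ ((2 * (v / d) ^+ 2 / N) `^ al)).
    have yy : 0 < (x + u) * (1 - (x + u)) by apply: lt_le_trans ry; rewrite divr_gt0.
    have A0 : 0 <= v ^+ 2 / ((x + u) * (1 - (x + u))).
      by rewrite divr_ge0 ?sqr_ge0 // (ltW yy).
    have B0 : 0 <= 2 * (v / d) ^+ 2 / N.
      by rewrite divr_ge0 ?(ltW N0) // mulr_ge0 // sqr_ge0.
    rewrite ge0_ler_powR ?nnegrE ?(ltW al0) // ler_pdivrMr //.
    have -> : 2 * (v / d) ^+ 2 / N * ((x + u) * (1 - (x + u))) =
      v ^+ 2 * ((x + u) * (1 - (x + u)) / (N * d ^+ 2 / 2)).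
      by field; rewrite !gt_eqF.
    by rewrite Nd2 ler_peMr ?sqr_ge0 // ler_pdivlMr ?mul1r // divr_gt0.
  apply: le_trans (scale _ _) _.
    by rewrite divr_ge0 ?(ltW N0) // mulr_ge0 // sqr_ge0.
  rewrite ler_wpM2l //.
  have -> : N * (2 * (v / d) ^+ 2 / N) = 2 * (v / d) ^+ 2 by field; rewrite !gt_eqF.
  by have := sqr_ge0 (v / d); lra.
have /= := @bern_local g n x (S d / d) (12 * (M * eps)) (d ^+ 2) n0 x01.
rewrite exprn_gt0 // => /(_ isT) H.
(* By the choice of [d] the second-moment term equals 1, hence [24 = 12 * 2]. *)
have -> : 24 * M * eps = 12 * (M * eps) * (1 + x * (1 - x) / N / d ^+ 2).
  by rewrite -/r -d2 divff ?expf_eq0 ?gt_eqF //; ring.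
apply: H => t /andP[t0 t1].
have -> : (t - x) ^+ 2 / d ^+ 2 = ((t - x) / d) ^+ 2 by rewrite exprMn exprVn.
have ES : g t - g x = S (t - x) by rewrite /S [x + _]addrC subrK.
have [tx|tx] := leP `|t - x| (r / 2).
  have := loc _ tx; rewrite -ES mulrAC [_ * S d]mulrC mulrA.
  by rewrite mulrAC.
(* Far from [x], the increment of [g] and the chord are bounded separately by multiples of
   [M eps (1 + q)]; [|t - x| > r / 2] makes [q] at most quadratic in [(t - x) / d]. *)
set q := N * `|t - x|.
have Hq : q <= 2 * ((t - x) / d) ^+ 2.
  have -> : ((t - x) / d) ^+ 2 = q * (`|t - x| / r).
    by rewrite exprMn exprVn -Nd2 -[(t - x) ^+ 2]real_normK ?num_real // /q; field;
      rewrite !gt_eqF.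
  have : 2^-1 <= `|t - x| / r by rewrite ler_pdivlMr // mulrC ltW.
  have : 0 <= q by rewrite mulr_ge0 // ltW.
  by move=> *; nra.
have H1 : `|g t - g x| <= M * eps * (1 + q).
  apply: le_trans (gH _ _ _ x01) _; first by rewrite t0.
  by rewrite -mulrA ler_wpM2l // scale.
have H2 : `|S d / d * (t - x)| <= M * eps * q.
  have Sd : `|S d| <= M * (eps * (N * d)).
    apply: le_trans (gH _ _ _ x01) _; first by apply: xu01; rewrite gtr0_norm.
    have -> : x + d - x = d by ring.
    rewrite gtr0_norm // ler_wpM2l // (powR_scale al n0 (ltW d0)) ler_wpM2l //.
    exact: ler1_powR.
  rewrite !normrM normfV (gtr0_norm d0).
  have -> : M * eps * q = M * (eps * (N * d)) / d * `|t - x|.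
    by rewrite /q; field; rewrite gt_eqF.
  by rewrite ler_wpM2r // ler_wpM2r // invr_ge0 ltW.
have := ler_normB (g t - g x) (S d / d * (t - x)).
have : M * eps * q <= M * eps * (2 * ((t - x) / d) ^+ 2) by rewrite ler_wpM2l.
have : 0 <= M * eps * ((t - x) / d) ^+ 2 by rewrite mulr_ge0 // sqr_ge0.
by move=> *; lra.
Qed.

End DirectTheorem.

(** * The inverse estimates *)

Section Iteration.
Context {R : realType}.
Implicit Types (v : nat -> R) (c rho D q al : R) (j A : nat).

(** Since [c <= rho / 2], half of [M rho ^ (j + 1)] absorbs [c v_j]. The term [2 |D| / rho] of [M]
    lets the other half absorb [D rho ^ j]; the first term of [M] covers [j0]. *)
Lemma geometric_recursion v D c rho j0 : 0 <= c -> 0 < rho -> c *+ 2 <= rho ->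
  (forall j, (j0 <= j)%N -> v j.+1 <= D * rho ^+ j + c * v j) ->
  exists2 M : R, 0 <= M & forall j, (j0 <= j)%N -> v j <= M * rho ^+ j.
Proof.
move=> c0 r0 cr H; pose M : R := `|v j0| / rho ^+ j0 + 2 * `|D| / rho.
have M0 : 0 <= M.
  by rewrite addr_ge0 // divr_ge0 ?exprn_ge0 ?mulr_ge0 // ltW.
exists M => // j /subnK <-; elim: (j - j0)%N => [|i IH].
  have rn0 : rho ^+ j0 != 0 by rewrite gt_eqF // exprn_gt0.
  rewrite add0n /M mulrDl (divfK rn0).
  apply: le_trans (ler_norm _) _; rewrite lerDl mulr_ge0 ?divr_ge0 ?mulr_ge0 ?exprn_ge0 //.
    exact: ltW.
  exact: ltW.
rewrite addSn; apply: le_trans (H _ (leq_addl _ _)) _.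
set P := rho ^+ (i + j0) in IH *; have P0 : 0 <= P by rewrite exprn_ge0 // ltW.
rewrite exprS -/P mulrA.
have h1 : D * P <= M * rho / 2 * P.
  rewrite ler_wpM2r // (le_trans (ler_norm D)) // ler_pdivlMr // mulrC.
  have -> : M * rho = `|v j0| / rho ^+ j0 * rho + 2 * `|D|.
    by rewrite [LHS]mulrDl divfK // gt_eqF.
  rewrite lerDr mulr_ge0 ?(ltW r0) // divr_ge0 //.
  by rewrite exprn_ge0 // ltW.
have h2 : c * v (i + j0)%N <= M * rho / 2 * P.
  apply: le_trans (ler_wpM2l c0 IH) _; rewrite mulrA ler_wpM2r // [c * M]mulrC -mulrA.
  by rewrite ler_wpM2l // ler_pdivlMr // mulr_natr.
by lra.
Qed.

Lemma exprn_scale A q : (1 < A)%N -> 0 < q <= 1 ->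
  exists j, A%:R ^+ j * q <= 1 < A%:R ^+ j.+1 * q.
Proof.
move=> A1 /andP[q0 q1].
have ex : exists j, 1 < A%:R ^+ j.+1 * q.
  exists (Num.truncn q^-1); rewrite -ltr_pdivrMr // mul1r.
  apply: (lt_trans (truncnS_gt _)); rewrite -natrX ltr_nat.
  exact: ltn_expl.
exists (ex_minn ex); case: ex_minnP => -[|j] -> m; rewrite andbT ?expr0 ?mul1r //.
by rewrite leNgt; apply/negP => /m; rewrite ltnn.
Qed.

Lemma powR_unbounded be c : 0 < be -> 0 <= c ->
  exists2 A : nat, (1 < A)%N & c <= A%:R `^ be.
Proof.
move=> b0 c0; exists (Num.truncn (c `^ be^-1)).+2 => //.
have E : (c `^ be^-1) `^ be = c by rewrite -powRrM mulVf ?gt_eqF // powRr1.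
rewrite -{1}E ge0_ler_powR ?(ltW b0) ?nnegrE ?powR_ge0 //.
by apply: ltW (lt_trans (truncnS_gt _) _); rewrite ltr_nat.
Qed.

Lemma powR_exprn (a al : R) j : 0 <= a -> (a ^+ j) `^ al = (a `^ al) ^+ j.
Proof.
move=> a0; elim: j => [|j IH]; first by rewrite !expr0 powR1.
by rewrite !exprS powRM ?exprn_ge0 // IH.
Qed.

Lemma natr_powR_exprn A al j : (A ^ j)%:R `^ al = (A%:R `^ al) ^+ j :> R.
Proof. by rewrite natrX powR_exprn. Qed.

End Iteration.

Section Inverse.
Context {R : realType}.
Implicit Types (W g : R -> R) (al C c G M : R).

(** For [h = A ^ (- j - 1)] and [n = A ^ j], the numbers [A ^ j W (A ^ (- j))] satisfy
    [geometric_recursion] with [rho = A ^ (1 - al)]; as [al < 1], a large [A] gives [2 c <= rho].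
    Monotonicity passes from powers of [A] to every [h]. *)
Lemma modulus_inverse W al C c G N0 : 0 < al < 1 -> 0 <= C -> 0 <= c -> (0 < N0)%N ->
  (forall s t, 0 < s <= t -> W s <= W t) -> (forall t, 0 < t -> 0 <= W t <= G) ->
  (forall n h, (N0 <= n)%N -> 0 < h ->
     W h <= C * n%:R `^ (- al) + c * h * n%:R * (W n%:R^-1 + n%:R^-1)) ->
  exists2 M : R, 0 <= M & forall h, 0 < h <= 1 -> W h <= M * h `^ al.
Proof.
move=> /andP[al0 al1] C0 c0 N00 Wmono WG H.
have [A A1 Ac] : exists2 A : nat, (1 < A)%N & c *+ 2 <= A%:R `^ (1 - al).
  by apply: powR_unbounded; rewrite ?subr_gt0 ?mulrn_wge0.
set a : R := A%:R in Ac; set rho := a `^ (1 - al) in Ac.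
have a1 : 1 < a by rewrite ltr1n.
have a0 : 0 < a by apply: lt_trans a1.
have rho0 : 0 < rho by apply: powR_gt0.
have rho1 : 1 <= rho.
  by rewrite -[leLHS](powRr0 a) ler_powR ?(ltW a1) // subr_ge0 ltW.
have rhoE j : rho ^+ j = a ^+ j * (A ^ j)%:R `^ (- al).
  rewrite natr_powR_exprn -exprMn; congr (_ ^+ _).
  by rewrite /rho powRD ?powRr1 ?(ltW a0) // (gt_eqF a0) /= implybT.
have Hj j : (N0 <= j)%N -> a ^+ j.+1 * W (a ^- j.+1) <=
    (C * a + c) * rho ^+ j + c * (a ^+ j * W (a ^- j)).
  (* [N0] is used as a bound on the exponent, which suffices since [j <= A ^ j]. *)
  move=> Nj; have NA : (N0 <= A ^ j)%N by apply: leq_trans Nj (ltnW (ltn_expl _ A1)).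
  have aj0 : 0 < a ^+ j by rewrite exprn_gt0.
  have := H (A ^ j)%N (a ^- j.+1) NA; rewrite invr_gt0 exprn_gt0 // => /(_ isT).
  rewrite -(ler_pM2l (exprn_gt0 j.+1 a0)) => /le_trans; apply.
  rewrite natrX -/a.
  have -> : a ^+ j.+1 * (C * (a ^+ j) `^ (- al) + c * a ^- j.+1 * a ^+ j
      * (W (a ^+ j)^-1 + (a ^+ j)^-1))
     = C * a * (a ^+ j * (a ^+ j) `^ (- al)) + c + c * (a ^+ j * W (a ^- j)).
    by rewrite exprS; field; rewrite !gt_eqF.
  have := rhoE j; rewrite natrX -/a => <-.
  rewrite [leRHS]addrC [leLHS]addrC lerD2l mulrDl lerD2l.
  by rewrite -[leLHS]mulr1 ler_wpM2l // exprn_ege1.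
have [M M0 HM] := geometric_recursion c0 rho0 Ac Hj.
exists (M * a `^ al + G * (a ^+ N0) `^ al).
  have /andP[W0 WG1] := WG 1 ltr01.
  by rewrite addr_ge0 // mulr_ge0 ?powR_ge0 //; apply: le_trans WG1.
move=> h h01; have /andP[h0 h1] := h01.
have [j /andP[j1 j2]] := exprn_scale A1 h01; rewrite -/a in j1 j2.
have G0 : 0 <= G by have /andP[] := WG 1 ltr01; exact: le_trans.
have [jN|jN] := leqP N0 j.
  apply: (@le_trans _ _ (M * a `^ al * h `^ al)); last first.
    by rewrite mulrDl lerDl !mulr_ge0 ?powR_ge0.
  have aj0 : 0 < a ^+ j by rewrite exprn_gt0.
  apply: (@le_trans _ _ (W (a ^- j))).
    by apply: Wmono; rewrite h0 /= -[leRHS]mul1r ler_pdivlMr // mulrC.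
  have := HM j jN; rewrite rhoE mulrCA ler_pM2l // => /le_trans; apply.
  rewrite -mulrA ler_wpM2l // -powRM ?(ltW a0) ?(ltW h0) // natrX -/a powRN.
  rewrite -[leLHS]mul1r ler_pdivrMr ?powR_gt0 // -powRM ?mulr_ge0 ?(ltW a0) ?(ltW h0) ?(ltW aj0) //.
  apply: (@le_trans _ _ (1 `^ al)); first by rewrite powR1.
  rewrite ge0_ler_powR ?(ltW al0) // ?nnegrE ?mulr_ge0 ?(ltW a0) ?(ltW h0) ?(ltW aj0) //.
  by rewrite mulrAC -exprS ltW.
(* At the finitely many coarse scales [j < N0] the trivial bound [G] is enough, because
   [A ^ N0 h >= 1]. *)
apply: (@le_trans _ _ (G * (a ^+ N0) `^ al * h `^ al)); last first.
  by rewrite mulrDl lerDr !mulr_ge0 ?powR_ge0.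
have aN0 : 0 <= a ^+ N0 by rewrite exprn_ge0 // ltW.
rewrite -mulrA -powRM ?(ltW h0) //.
apply: (@le_trans _ _ G); first by have /andP[] := WG h h0.
rewrite -[leLHS]mulr1 ler_wpM2l //; apply: (@le_trans _ _ (1 `^ al)); first by rewrite powR1.
rewrite ge0_ler_powR ?(ltW al0) // ?nnegrE ?mulr_ge0 ?(ltW h0) //.
apply: (le_trans (ltW j2)); rewrite ler_wpM2r ?(ltW h0) //.
by rewrite ler_weXn2l // ltW.
Qed.

(* With [p_j] the Bernstein polynomial of [g] of degree [A ^ j.+1], the bound
   for [x (1 - x) p_j''] satisfies [K_(j+1) <= c A^(j (1 - al)) + 2 K_j]. *)
Lemma bern_inverse g al C G : 0 < al < 1 -> 0 <= C ->
  (forall x, 0 <= x <= 1 -> `|g x| <= G) ->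
  (forall n x, (0 < n)%N -> 0 <= x <= 1 ->
     `|(bern n (fun k => g (k%:R / n%:R))).[x] - g x| <= C * n%:R `^ (- al)) ->
  exists2 M : R, 0 <= M & forall y u, 0 < y < 1 -> 0 < u -> 0 <= y - u -> y + u <= 1 ->
    `|g (y + u) - g y *+ 2 + g (y - u)| <= M * (u ^+ 2 / (y * (1 - y))) `^ al.
Proof.
move=> /andP[al0 al1] C0 gG gC.
have [A A1 Ac] : exists2 A : nat, (1 < A)%N & (2 : R) *+ 2 <= A%:R `^ (1 - al).
  by apply: powR_unbounded; rewrite ?subr_gt0 ?mulrn_wge0.
set a : R := A%:R in Ac; set rho := a `^ (1 - al) in Ac.
have a1 : 1 < a by rewrite ltr1n.
have a0 : 0 < a by apply: lt_trans a1.
have rho0 : 0 < rho by apply: powR_gt0.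
have rhoE j : rho ^+ j = a ^+ j * (A ^ j)%:R `^ (- al).
  rewrite natr_powR_exprn -exprMn; congr (_ ^+ _).
  by rewrite /rho powRD ?powRr1 ?(ltW a0) // (gt_eqF a0) /= implybT.
have A0 : (0 < A)%N := ltnW A1.
(* The shifted exponent keeps the degree at least 2 even for [j = 0], as [bern_deriv2_le]
   requires. *)
pose m j := (A ^ j.+1)%N.
have m2 j : (2 <= m j)%N.
  by apply: leq_trans A1 _; rewrite /m expnS leq_pmulr // expn_gt0 A0.
pose p j := bern (m j) (fun k => g (k%:R / (m j)%:R)).
pose fix K j : R := if j is i.+1 then 5 * (m i.+1)%:R * (C * (m i)%:R `^ (- al)) + 2 * K i
                else 5 * (m 0%N)%:R * G.
have KP j x : 0 <= x <= 1 -> `|x * (1 - x) * (p j)^`(2).[x]| <= K j.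
  elim: j x => [|j IH] x x01.
    have mm := subnK (m2 0%N); rewrite addn2 in mm.
    rewrite [K 0%N]/(5 * (m 0%N)%:R * G) /p -mm; apply: bern_deriv2_le => // k kn.
    exact/gG/node01.
  have mm := subnK (m2 j.+1); rewrite addn2 in mm.
  (* The values of [g - p_j] are small, which suits [bern_deriv2_le]; [p_j] has a bounded weighted
     second derivative by induction, which suits [bern_deriv2_stable]. *)
  have -> : p j.+1 = bern (m j.+1) (fun k => g (k%:R / (m j.+1)%:R) - (p j).[k%:R / (m j.+1)%:R])
     + bern (m j.+1) (fun k => (p j).[k%:R / (m j.+1)%:R]).
    by rewrite -bernD; apply: eq_bern => k _; rewrite subrK.
  rewrite derivnD hornerD mulrDr; apply: le_trans (ler_normD _ _) _.
  rewrite [K j.+1]/(5 * (m j.+1)%:R * (C * (m j)%:R `^ (- al)) + 2 * K j).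
  rewrite lerD //; rewrite -mm.
    apply: bern_deriv2_le => // k; rewrite distrC mm => kn; apply: gC.
      by rewrite /m expn_gt0 A0.
    exact: node01.
  by apply: bern_deriv2_stable => // y /andP[? ?]; apply: IH; rewrite !ltW.
have [M M0 HM] : exists2 M : R, 0 <= M & forall j, (0 <= j)%N -> K j <= M * rho ^+ j.
  apply: (@geometric_recursion _ K (5 * a * a * C * a `^ (- al)) 2 rho 0%N) => // j _ /=.
  rewrite lerD2r rhoE /m !natr_powR_exprn natrX -/a !exprS le_eqVlt.
  by apply/orP; left; apply/eqP; ring.
exists (4 * C + 2 * M); first by rewrite addr_ge0 // mulr_ge0.
move=> y u y01 u0 yu uy; have /andP[y0 y1] := y01.
have r0 : 0 < y * (1 - y) by rewrite mulr_gt0 // subr_gt0.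
set q := u ^+ 2 / (y * (1 - y)).
have q01 : 0 < q <= 1.
  rewrite divr_gt0 ?exprn_gt0 //= ler_pdivrMr // mul1r expr2.
  by rewrite ler_pM ?(ltW u0) //; lra.
have /andP[q0 q1] := q01.
(* This [j] balances two errors: [A ^ (j + 1) q > 1] bounds [(m j) ^ (- al)] by [q ^ al], and
   [A ^ j q <= 1] bounds [rho ^ j q] by [q ^ al]. *)
have [j /andP[j1 j2]] := exprn_scale A1 q01; rewrite -/a in j1 j2.
have D1 : `|(p j).[y + u] - (p j).[y] *+ 2 + (p j).[y - u]| <= 2 * K j * q.
  rewrite /q mulrA; apply: second_diff_poly => //; try lra.
  by move=> z /andP[? ?]; apply: KP; rewrite !ltW.
have E x : 0 <= x <= 1 -> `|(p j).[x] - g x| <= C * q `^ al.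
  move=> x01; apply: le_trans (gC _ _ _ x01) _; first by rewrite /m expn_gt0 A0.
  rewrite ler_wpM2l // powRN -[leLHS]mul1r ler_pdivrMr; last first.
    by rewrite powR_gt0 // ltr0n /m expn_gt0 A0.
  rewrite -powRM ?(ltW q0) //; apply: (@le_trans _ _ (1 `^ al)); first by rewrite powR1.
  rewrite ge0_ler_powR ?(ltW al0) // ?nnegrE ?(mulr_ge0 (ltW q0)) //.
  by rewrite mulrC /m natrX ltW.
have Kq : K j * q <= M * q `^ al.
  apply: le_trans (ler_wpM2r (ltW q0) (HM j isT)) _; rewrite -mulrA ler_wpM2l //.
  have -> : q `^ al = q `^ (- (1 - al)) * q.
    rewrite -{3}(powRr1 (ltW q0)) -powRD; last by rewrite (gt_eqF q0) /= implybT.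
    by congr (_ `^ _); ring.
  rewrite ler_wpM2r ?(ltW q0) // powRN -[leRHS]mul1r ler_pdivlMr ?powR_gt0 //.
  rewrite /rho -powR_exprn ?(ltW a0) // -powRM ?(ltW q0) ?exprn_ge0 ?(ltW a0) //.
  apply: (@le_trans _ _ (1 `^ (1 - al))); last by rewrite powR1.
  rewrite ge0_ler_powR ?subr_ge0 ?(ltW al1) // ?nnegrE //.
  by rewrite mulr_ge0 ?exprn_ge0 ?(ltW a0) ?(ltW q0).
have yp01 : 0 <= y + u <= 1 by apply/andP; split; lra.
have ym01 : 0 <= y - u <= 1 by apply/andP; split; lra.
have yy01 : 0 <= y <= 1 by rewrite !ltW.
have := E _ yp01; have := E _ ym01; have := E _ yy01.
move: D1; rewrite !ler_norml => *; lra.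
Qed.

End Inverse.

(** * Taylor's formula on [0, 1] *)

Section Derivative01.
Context {R : realType}.
Implicit Types (f h : R -> R) (x y l e : R) (p : {poly R}).

(** The limit within [[0, 1]] with the quotient multiplied out, so that [y = x] needs no
    exclusion. *)
Definition is_deriv01 f x l := forall e, 0 < e -> exists2 d, 0 < d &
  forall y, 0 <= y <= 1 -> `|y - x| < d -> `|f y - f x - l * (y - x)| <= e * `|y - x|.

Lemma derivable01_is_deriv01 f x : derivable01 f x -> is_deriv01 f x (deriv01 f x).
Proof.
move=> /cvgrPdist_le H e e0; have := H e e0.
rewrite /within /dnbhs /within /= => /nbhs_ballP[d /= d0 Hd]; exists d => // y y01 yx.
have [->|yNx] := eqVneq y x; first by rewrite !subrr mulr0 subrr normr0 mulr0.
have := Hd y; rewrite /ball /= distrC => /(_ yx yNx); rewrite in_itv /= => /(_ y01).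
rewrite -/(deriv01 f x) distrC => {}Hd.
have yx0 : y - x != 0 by rewrite subr_eq0.
have -> : f y - f x - deriv01 f x * (y - x) = ((f y - f x) / (y - x) - deriv01 f x) * (y - x).
  by rewrite mulrBl divfK.
by rewrite normrM ler_wpM2r.
Qed.

(** Makes limits of difference quotients unique, also at 0 and 1. A nearby point is found by moving
    from [x] into the longer side, by at most [1 / 2]. *)
Lemma within01_proper x : 0 <= x <= 1 -> ProperFilter (within `[0, 1] x^').
Proof.
move=> /andP[x0 x1]; split; last exact: within_filter.
rewrite /within /dnbhs /within /= => /nbhs_ballP[d /= d0 Hd].
pose y := if x <= 2^-1 then x + Num.min (d / 2) 2^-1 else x - Num.min (d / 2) 2^-1.
have m0 : 0 < Num.min (d / 2) 2^-1 by rewrite lt_min divr_gt0 //= invr_gt0.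
have m1 : Num.min (d / 2) 2^-1 <= d / 2 by rewrite ge_min lexx.
have m2 : Num.min (d / 2) 2^-1 <= 2^-1 by rewrite ge_min lexx orbT.
apply: (Hd y).
- rewrite /ball /= /y; move: m0 m1 m2; set m := Num.min _ _ => m0 m1 m2.
  by case: ifP => _; rewrite ltr_norml; apply/andP; split; lra.
- by rewrite /y; case: ifP => _; rewrite -subr_eq0; apply/eqP; lra.
- rewrite in_itv /= /y; move: m0 m1 m2; set m := Num.min _ _ => m0 m1 m2.
  by case: (leP x 2^-1) => ?; apply/andP; split; lra.
Qed.

Lemma is_deriv01_lim f x l : 0 <= x <= 1 -> is_deriv01 f x l -> deriv01 f x = l.
Proof.
move=> x01 H; have PF := within01_proper x01.
apply: cvg_lim; first exact: Rhausdorff.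
apply/cvgrPdist_le => e e0; have [d d0 Hd] := H e e0.
rewrite /within /dnbhs /within /=; apply/nbhs_ballP; exists d => //= y.
rewrite /ball /= distrC in_itv /= => yx yNx y01.
have yx0 : y - x != 0 by rewrite subr_eq0.
have := Hd y y01 yx.
have -> : f y - f x - l * (y - x) = ((f y - f x) / (y - x) - l) * (y - x).
  by rewrite mulrBl divfK.
by rewrite normrM ler_pM2r ?normr_gt0 // distrC.
Qed.

Lemma eq_is_deriv01 f h x l : (forall y, 0 <= y <= 1 -> f y = h y) -> 0 <= x <= 1 ->
  is_deriv01 h x l -> is_deriv01 f x l.
Proof.
move=> fh x01 H e e0; have [d d0 Hd] := H e e0; exists d => // y y01 yx.
by rewrite !fh //; exact: Hd.
Qed.

(** Dividing [p - p(x)] by [X - x] gives a continuous [q] with [q(x) = p'(x)], and the difference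
    quotient at [y] is [q(y)]. *)
Lemma is_deriv01_poly p x : is_deriv01 (horner p) x p^`().[x].
Proof.
have [q Eq] : exists q, p - p.[x]%:P = q * ('X - x%:P).
  by apply/factor_theorem; rewrite /root !hornerE subrr.
have Ep : p = p.[x]%:P + q * ('X - x%:P) by rewrite -Eq addrC subrK.
have Ed : p^`().[x] = q.[x].
  rewrite Ep derivD derivC add0r derivM derivB derivX derivC subr0 mulr1.
  by rewrite !(hornerD, hornerM, hornerN, hornerX, hornerC) subrr mulr0 add0r.
move=> e e0; have /cvgrPdist_le /(_ e e0) := @continuous_horner R q x.
move=> /nbhs_ballP[d /= d0 Hd]; exists d => // y _ yx.
have := Hd y; rewrite /ball /= distrC => /(_ yx); rewrite distrC => {}Hd.
have -> : p.[y] - p.[x] - p^`().[x] * (y - x) = (q.[y] - q.[x]) * (y - x).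
  rewrite Ed {1}Ep !(hornerD, hornerM, hornerN, hornerX, hornerC); ring.
by rewrite normrM ler_wpM2r.
Qed.

Lemma is_deriv01B f h x l m : is_deriv01 f x l -> is_deriv01 h x m ->
  is_deriv01 (fun y => f y - h y) x (l - m).
Proof.
move=> Hf Hh e e0; have e20 : 0 < e / 2 by rewrite divr_gt0.
have [d1 d10 H1] := Hf _ e20; have [d2 d20 H2] := Hh _ e20.
exists (Num.min d1 d2); first by rewrite lt_min d10.
move=> y y01; rewrite lt_min => /andP[/(H1 y y01) A /(H2 y y01) B].
have -> : f y - h y - (f x - h x) - (l - m) * (y - x) =
  (f y - f x - l * (y - x)) - (h y - h x - m * (y - x)) by ring.
by apply: le_trans (ler_normB _ _) _; lra.
Qed.

Lemma is_deriv01_is_derive f x l : 0 < x < 1 -> is_deriv01 f x l -> is_derive x 1 f l.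
Proof.
move=> /andP[x0 x1] H; apply/is_derive1_caratheodory.
exists (fun y => if y == x then l else (f y - f x) / (y - x)); split => //.
- by move=> y; case: eqP => [->|/eqP yx]; rewrite ?subrr ?mulr0 // divfK // subr_eq0.
- apply/cvgrPdist_le => /= e e0; rewrite eqxx.
  have [d d0 Hd] := H e e0; apply/nbhs_ballP.
  exists (Num.min d (Num.min x (1 - x))) => /=.
    by rewrite !lt_min d0 x0 subr_gt0.
  move=> y; rewrite /ball /= distrC !lt_min => /and3P[yd yx yx1].
  case: eqP => [_|/eqP yNx]; first by rewrite subrr normr0 ltW.
  have y01 : 0 <= y <= 1.
    by move: yx yx1; rewrite !ltr_norml => /andP[? ?] /andP[? ?]; apply/andP; split; lra.
  have yx0 : y - x != 0 by rewrite subr_eq0.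
  have := Hd y y01 yd.
  have -> : f y - f x - l * (y - x) = ((f y - f x) / (y - x) - l) * (y - x).
    by rewrite mulrBl divfK.
  by rewrite normrM ler_pM2r ?normr_gt0 // distrC.
- by rewrite eqxx.
Qed.

Lemma is_deriv01_continuous f (df : R -> R) :
  (forall x, 0 <= x <= 1 -> is_deriv01 f x (df x)) -> {within `[0, 1], continuous f}.
Proof.
move=> H; apply/subspace_continuousP => x; rewrite /= in_itv /= => x01.
apply/cvgrPdist_le => e e0; have [d d0 Hd] := H x x01 1 ltr01.
rewrite /within /=; apply/nbhs_ballP.
have L0 : 0 < 1 + `|df x| by rewrite ltr_pwDl.
exists (Num.min d (e / (1 + `|df x|))) => /=; first by rewrite lt_min d0 divr_gt0.
move=> y; rewrite /ball /= distrC lt_min in_itv /= => /andP[yd ye] y01.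
have B := Hd y y01 yd; rewrite mul1r in B.
rewrite ltr_pdivlMr // in ye.
have : `|f y - f x| <= `|f y - f x - df x * (y - x)| + `|df x * (y - x)|.
  by apply: le_trans (ler_normD _ _); rewrite subrK.
by rewrite normrM [`|f x - f y|]distrC; lra.
Qed.

(** The mean value theorem takes derivatives at interior points, where [is_deriv01] is the usual
    notion; the endpoints enter through continuity. The bound on [df] is local because the Taylor
    induction supplies no more. *)
Lemma mean_value01 f (df : R -> R) x y e :
  (forall t, 0 <= t <= 1 -> is_deriv01 f t (df t)) -> 0 <= x <= 1 -> 0 <= y <= 1 ->
  (forall t, 0 <= t <= 1 -> `|t - x| <= `|y - x| -> `|df t| <= e) ->
  `|f y - f x| <= e * `|y - x|.
Proof.
move=> H x01 y01 He; have /andP[x0 x1] := x01; have /andP[y0 y1] := y01.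
have mv a b : 0 <= a -> a < b -> b <= 1 ->
    exists2 c, a < c < b & f b - f a = df c * (b - a).
  move=> a0 ab b1; have [||c] := @MVT R f df a b ab.
  - move=> t; rewrite in_itv /= => /andP[at_ tb].
    by apply: is_deriv01_is_derive; [|apply: H]; apply/andP; split; lra.
  - apply: continuous_subspaceW (is_deriv01_continuous H) => t /=.
    by rewrite !in_itv /= => /andP[? ?]; apply/andP; split; lra.
  by rewrite in_itv /= => cab E; exists c.
have [xy|yx|<-] := ltgtP x y; last by rewrite !subrr normr0 mulr0.
- have [c /andP[xc cy] ->] := mv x y x0 xy y1.
  rewrite normrM ler_wpM2r // He //; first by apply/andP; split; lra.
  by rewrite !gtr0_norm ?subr_gt0 //; lra.
- have [c /andP[yc cx] E] := mv y x y0 yx x1.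
  rewrite distrC E normrM distrC ler_wpM2r // He //; first by apply/andP; split; lra.
  by rewrite !ltr0_norm ?subr_lt0 //; lra.
Qed.

End Derivative01.

Section Taylor.
Context {R : realType}.
Implicit Types (f : R -> R) (x y e : R) (s i : nat) (p : {poly R}).

Lemma derivn01S i f : derivn01 i.+1 f = derivn01 i (deriv01 f).
Proof. exact: iterSr. Qed.

Lemma derivn01_poly f p s : (forall x, 0 <= x <= 1 -> f x = p.[x]) ->
  forall x, 0 <= x <= 1 -> derivn01 s f x = p^`(s).[x].
Proof.
move=> fp; elim: s => [|s IH] x x01; first by rewrite derivn0 -fp.
rewrite derivnS; apply: is_deriv01_lim => //.
exact: eq_is_deriv01 IH x01 (is_deriv01_poly _ _).
Qed.

Definition taylor01 s f x : {poly R} :=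
  \sum_(i < s.+1) (derivn01 i f x / i`!%:R)%:P * ('X - x%:P) ^+ i.

Lemma taylor01_horner s f x y :
  (taylor01 s f x).[y] = \sum_(i < s.+1) derivn01 i f x / i`!%:R * (y - x) ^+ i.
Proof.
rewrite /taylor01 horner_sum; apply: eq_bigr => i _.
by rewrite hornerM hornerC horner_exp hornerD hornerX hornerN hornerC.
Qed.

Lemma deriv_taylor01 s f x : (taylor01 s.+1 f x)^`() = taylor01 s (deriv01 f) x.
Proof.
rewrite /taylor01 big_ord_recl derivD expr0 mulr1 derivC add0r linear_sum.
apply: eq_bigr => i _; rewrite /= /bump leq0n add1n.
rewrite derivM derivC mul0r add0r deriv_exp derivB derivX derivC subr0 mul1r /=.
rewrite add0n -[deriv01 (derivn01 i f)]/(derivn01 i.+1 f) derivn01S.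
rewrite mulrnAr -mulrnAl -polyCMn; congr (_%:P * _).
have : i.+1%:R != 0 :> R by rewrite pnatr_eq0.
have : i`!%:R != 0 :> R by rewrite pnatr_eq0 -lt0n fact_gt0.
rewrite -[_ / _ *+ i.+1]mulr_natr factS natrM => v0 u0.
by rewrite invfM mulrA mulrAC divfK.
Qed.

(** Induction on [s]: the remainder vanishes at [x] and its derivative is the remainder of one order
    less for [deriv01 f], so [mean_value01] gains a factor [|y - x|] each time. *)
Lemma taylor01P s f x y e :
  (forall i t, (i < s)%N -> 0 <= t <= 1 -> derivable01 (derivn01 i f) t) ->
  0 <= x <= 1 -> 0 <= y <= 1 ->
  (forall t, 0 <= t <= 1 -> `|t - x| <= `|y - x| ->
     `|derivn01 s f t - derivn01 s f x| <= e) ->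
  `|f y - (taylor01 s f x).[y]| <= e * `|y - x| ^+ s.
Proof.
elim: s f y => [|s IH] f y Df x01 y01 He.
  rewrite taylor01_horner big_ord1 /= fact0 divr1 expr0 !mulr1.
  exact: He.
have e0 : 0 <= e by apply: le_trans (He x x01 _); rewrite ?subrr ?normr0.
have E t : 0 <= t <= 1 -> `|t - x| <= `|y - x| ->
    `|deriv01 f t - (taylor01 s (deriv01 f) x).[t]| <= e * `|y - x| ^+ s.
  move=> t01 tx; apply: (@le_trans _ _ (e * `|t - x| ^+ s)).
    apply: IH => //; first by move=> i u si u01; rewrite -derivn01S; exact: Df.
    move=> u u01 ux; rewrite -derivn01S; apply: He => //.
    exact: le_trans ux tx.
  by rewrite ler_wpM2l // lerXn2r // nnegrE.
have := @mean_value01 R (fun t => f t - (taylor01 s.+1 f x).[t])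
  (fun t => deriv01 f t - (taylor01 s (deriv01 f) x).[t]) x y (e * `|y - x| ^+ s).
have -> : f x - (taylor01 s.+1 f x).[x] = 0.
  rewrite taylor01_horner big_ord_recl big1 ?addr0.
    by rewrite /= fact0 divr1 expr0 mulr1 subrr.
  by move=> i _; rewrite subrr expr0n mulr0.
rewrite subr0 exprSr mulrA; apply => //.
move=> t t01; apply: is_deriv01B; first exact: derivable01_is_deriv01 (Df 0%N t isT t01).
by rewrite -deriv_taylor01; exact: is_deriv01_poly.
Qed.

End Taylor.

(** * Rounded Bernstein coefficients *)

Section FiniteDifference.
Context {R : realType}.
Implicit Types (a : nat -> R) (s k i j n : nat) (c : R).

Lemma iter_fdiff_shift s a k : iter s fdiff (fun i => a (k + i)%N) 0%N = iter s fdiff a k.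
Proof.
rewrite -[k in RHS]addn0; move: 0%N; elim: s => [//|s IH] i /=.
by rewrite /fdiff !IH addnS.
Qed.

Lemma iter_fdiff_sum s m (c : 'I_m -> R) (a : 'I_m -> nat -> R) k :
  iter s fdiff (fun i => \sum_(l < m) c l * a l i) k
  = \sum_(l < m) c l * iter s fdiff (a l) k.
Proof.
elim: s k => [//|s IH] k /=; rewrite /fdiff !IH -sumrB.
by apply: eq_bigr => l _; rewrite mulrBr.
Qed.

Lemma iter_fdiffD s a b k :
  iter s fdiff (fun i => a i + b i) k = iter s fdiff a k + iter s fdiff b k :> R.
Proof. by elim: s k => [//|s IH] k /=; rewrite /fdiff !IH opprD addrACA. Qed.

Lemma norm_iter_fdiff s a k c : (forall i, (i <= s)%N -> `|a (k + i)%N| <= c) ->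
  `|iter s fdiff a k| <= 2 ^+ s * c.
Proof.
elim: s k => [|s IH] k ac /=; first by rewrite mul1r; have := ac 0%N isT; rewrite addn0.
rewrite /fdiff exprS mulr_natl mulr2n mulrDl.
apply: le_trans (ler_normB _ _) _; rewrite lerD // IH // => i si.
  by rewrite addSnnS; exact: ac.
exact/ac/leqW.
Qed.

(** By the binomial theorem one difference turns [i ^ j] into [j i ^ (j - 1)] plus lower powers. *)
Lemma iter_fdiff_exprn s j k : (j <= s)%N ->
  iter s fdiff (fun i => i%:R ^+ j) k = (j == s)%:R * s`!%:R :> R.
Proof.
elim: s j k => [|s IH] j k js.
  by move: js; rewrite leqn0 => /eqP -> /=; rewrite fact0 mul1r.
have -> : iter s.+1 fdiff (fun i => i%:R ^+ j) k =
    iter s fdiff (fun i => \sum_(l < j) 'C(j, l)%:R * i%:R ^+ l : R) k.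
  rewrite iterSr; congr (iter s fdiff _ k); apply/funext => i.
  rewrite /fdiff -nat1r exprDn big_ord_recr /= binn mulr1n expr1n mul1r addrK.
  by apply: eq_bigr => l _; rewrite expr1n mul1r mulr_natl.
rewrite iter_fdiff_sum; have [->|jNs] := eqVneq j s.+1; last first.
  rewrite mul0r big1 // => l _; have ls : (l < s)%N.
    by apply: leq_trans (ltn_ord l) _; rewrite -ltnS ltn_neqAle jNs.
  by rewrite IH ?(ltnW ls) // (ltn_eqF ls) mul0r mulr0.
rewrite big_ord_recr /= big1 => [|l _]; last first.
  by rewrite IH ?(ltnW (ltn_ord l)) // (ltn_eqF (ltn_ord l)) mul0r mulr0.
by rewrite add0r IH // eqxx !mul1r binSn -natrM factS.
Qed.

(** The new factor [n - s] loses a share [s / n], within the increase [(2 s + 1) / n] of the allowed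
    loss. *)
Lemma ffact_ratio n s : (s <= n)%N ->
  (1 - s%:R ^+ 2 / n%:R) * n%:R ^+ s <= (n ^_ s)%:R :> R /\
  (n ^_ s)%:R <= n%:R ^+ s :> R.
Proof.
elim: s => [|s IH] sn; first by rewrite !expr0 expr0n /= mul0r subr0 mul1r.
have n0 : 0 < n%:R :> R by rewrite ltr0n; case: n sn {IH}.
have [A B] := IH (ltnW sn).
rewrite ffactnSr natrM natrB ?(ltnW sn) // [n%:R ^+ s.+1]exprSr.
have sn' : s%:R <= n%:R :> R by rewrite ler_nat ltnW.
set N : R := n%:R in n0 A B sn' *; set P := N ^+ s in A B *.
set F : R := (n ^_ s)%:R in A B *; set S : R := s%:R in A sn' *.
have F0 : 0 <= F by []; have S0 : 0 <= S by [].
have P0 : 0 <= P by apply: le_trans B.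
split; last first.
  by rewrite ler_pM // ?subr_ge0 // lerBlDr lerDl.
have -> : s.+1%:R = S + 1 by rewrite /S natr1.
have -> : (1 - (S + 1) ^+ 2 / N) * (P * N) = (1 - S ^+ 2 / N) * P * N - (2 * S + 1) * P.
  by field; rewrite gt_eqF.
have h1 := ler_wpM2r (ltW n0) A.
have h2 : F * S <= P * S by rewrite ler_wpM2r.
have h3 : 0 <= P * S by rewrite mulr_ge0.
by rewrite mulrBr; lra.
Qed.

Lemma expn_leq_ffact k r : (k ^ r <= (k + r) ^_ r)%N.
Proof.
elim: r => [//|r IH]; rewrite addnS ffactSS expnS leq_mul //.
by rewrite -addnS leq_addr.
Qed.

(** [r! C(n, k) >= r! C(k + r, r) = (k + r) ... (k + 1) >= k ^ r], and [k >= n / 2]. *)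
Lemma expn_leq_bin n k r : (n <= 2 * k)%N -> (k + r <= n)%N ->
  (n ^ r <= 2 ^ r * r`! * 'C(n, k))%N.
Proof.
move=> nk kr; apply: (@leq_trans (2 ^ r * k ^ r)).
  by rewrite -expnMn; case: r kr => // r _; rewrite leq_exp2r.
rewrite -mulnA leq_mul2l; apply/orP; right; rewrite mulnC.
apply: leq_trans (expn_leq_ffact k r) _; rewrite -bin_ffact leq_mul2r.
by rewrite -(bin_sub (leq_addl k r)) addnK leq_bin2l ?orbT.
Qed.

End FiniteDifference.

Section RoundedCoefficients.
Context {R : realType}.
Variables (rnd : R -> int) (f : R -> R) (s : nat).
Hypothesis rndP : nearest_int rnd.
Hypothesis s0 : (0 < s)%N.
Implicit Types (n m k i : nat) (x W : R).

(** The binomial coefficient is divided out because [bernE] supplies it again. *)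
Definition coef_int n k : R := (rnd (f (k%:R / n%:R) * 'C(n, k)%:R))%:~R / 'C(n, k)%:R.

Lemma bernstein_intE n x : bernstein_int rnd n f x = (bern n (coef_int n)).[x].
Proof.
rewrite bernE horner_sum; apply: eq_bigr => k _.
rewrite !(hornerM, horner_exp, hornerC, hornerX, hornerD, hornerN) /coef_int divfK //.
by rewrite pnatr_eq0 -lt0n bin_gt0 -ltnS.
Qed.

(** The integer [z C(n, k)] competes with the rounded value and cannot be nearer. Near the endpoints
    [z] will be a Taylor polynomial, in the middle a floor divided by [C(n, k)]. *)
Lemma round_error n k (z : R) : (k <= n)%N -> z * 'C(n, k)%:R \is a Num.int ->
  `|coef_int n k - f (k%:R / n%:R)| <= `|f (k%:R / n%:R) - z|.
Proof.
move=> kn /intrP[m zm].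
have C0 : 0 < 'C(n, k)%:R :> R by rewrite ltr0n bin_gt0.
rewrite -(ler_pM2r C0) -(gtr0_norm C0) -!normrM !mulrBl divfK ?gt_eqF //.
by rewrite zm distrC; exact: rndP.
Qed.

(** From [i C(n, i) = n C(n - 1, i - 1)]. *)
Lemma binom_int n i (c d : R) : c \is a Num.int -> d \is a Num.int ->
  (c + d * (i%:R / n%:R)) * 'C(n, i)%:R \is a Num.int.
Proof.
move=> ci di; case: n => [|n].
  by rewrite invr0 !mulr0 addr0 rpredM // natr_int.
have -> : (c + d * (i%:R / n.+1%:R)) * 'C(n.+1, i)%:R =
    c * 'C(n.+1, i)%:R + d * ((i * 'C(n.+1, i))%:R / n.+1%:R).
  by rewrite natrM mulrDl -[d * _ * _]mulrA [_ / _ * _]mulrAC.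
case: i => [|i]; first by rewrite mul0n mul0r mulr0 addr0 rpredM // natr_int.
rewrite -mul_bin_diag natrM mulrAC divff ?pnatr_eq0 // mul1r.
by rewrite rpredD // rpredM // natr_int.
Qed.

Lemma round_error_mid n k : (0 < n)%N -> (s < k)%N -> (s < n - k)%N ->
  `|coef_int n k - f (k%:R / n%:R)| * n%:R ^+ s <= (2 ^ s.+1 * (s.+1)`!)%:R / n%:R.
Proof.
move=> n0 sk snk; have kn : (k <= n)%N by apply: ltnW; rewrite -subn_gt0 (leq_trans _ snk).
have C0 : 0 < 'C(n, k)%:R :> R by rewrite ltr0n bin_gt0.
have nr0 : 0 < n%:R :> R by rewrite ltr0n.
set v := f (k%:R / n%:R).
have B : `|coef_int n k - v| <= 'C(n, k)%:R^-1.
  apply: le_trans (@round_error n k ((Num.floor (v * 'C(n, k)%:R))%:~R / 'C(n, k)%:R) kn _) _.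
    by rewrite divfK ?gt_eqF // intr_int.
  rewrite -(ler_pM2r C0) mulVf ?gt_eqF // -[X in `|_| * X](gtr0_norm C0) -normrM mulrBl.
  rewrite divfK ?gt_eqF //.
  have := floor_itv (v * 'C(n, k)%:R); rewrite intrD => /andP[a b].
  by rewrite ger0_norm ?subr_ge0 // lerBlDl ltW.
(* By symmetry [expn_leq_bin] is applied to the larger of [k] and [n - k]; the smaller exceeds [s],
   which leaves room for [r = s + 1]. *)
have N : (n ^ s.+1 <= 2 ^ s.+1 * (s.+1)`! * 'C(n, k))%N.
  have [nk|nk] := leqP n (2 * k); first by apply: expn_leq_bin => //; lia.
  by rewrite -bin_sub //; apply: expn_leq_bin; lia.
rewrite ler_pdivlMr // -mulrA -exprSr.
apply: (@le_trans _ _ ('C(n, k)%:R^-1 * n%:R ^+ s.+1)).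
  by rewrite ler_wpM2r // exprn_ge0 // ltW.
by rewrite mulrC ler_pdivrMr // -natrX -natrM ler_nat.
Qed.

Hypothesis Df : forall i t, (i < s)%N -> 0 <= t <= 1 -> derivable01 (derivn01 i f) t.

Section Modulus.
Variables (n : nat) (W : R).
Hypothesis n0 : (0 < n)%N.
Hypothesis oscW : forall t u, 0 <= t <= 1 -> 0 <= u <= 1 -> `|t - u| <= s%:R / n%:R ->
  `|derivn01 s f t - derivn01 s f u| <= W.

Let W0 : 0 <= W.
Proof.
have := @oscW 0 0; rewrite !subrr normr0 lexx ler01 => -> //.
Qed.

Lemma taylor01_node x y : 0 <= x <= 1 -> 0 <= y <= 1 -> `|y - x| <= s%:R / n%:R ->
  `|f y - (taylor01 s f x).[y]| <= W * (s%:R / n%:R) ^+ s.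
Proof.
move=> x01 y01 yx; apply: (@le_trans _ _ (W * `|y - x| ^+ s)).
  by apply: taylor01P => // t t01 tx; apply: oscW => //; exact: le_trans yx.
by rewrite ler_wpM2l // lerXn2r // nnegrE // divr_ge0.
Qed.

Lemma taylor01_collapse x y : (forall i, (2 <= i <= s)%N -> derivn01 i f x = 0) ->
  (taylor01 s f x).[y] = f x + deriv01 f x * (y - x).
Proof.
case: s s0 => // s' _ H; rewrite taylor01_horner !big_ord_recl big1 => [|i _].
  by rewrite /= /bump /= !divr1 expr0 mulr1 addr0 expr1.
by rewrite H ?mul0r //= /bump /= !add1n !ltnS.
Qed.

(** The Taylor polynomial at 0 collapses to [f 0 + f'(0) y], an admissible [z] in [round_error] by
    [binom_int]. *)
Lemma round_error_left k : f 0 \is a Num.int -> deriv01 f 0 \is a Num.int ->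
  (forall i, (2 <= i <= s)%N -> derivn01 i f 0 = 0) -> (k <= n)%N -> (k <= s)%N ->
  `|coef_int n k - f (k%:R / n%:R)| <= W * (s%:R / n%:R) ^+ s.
Proof.
move=> f0 f'0 H kn ks; have ni0 : 0 < n%:R^-1 :> R by rewrite invr_gt0 ltr0n.
apply: le_trans (round_error kn (binom_int n k f0 f'0)) _.
have := taylor01_collapse (k%:R / n%:R) H; rewrite subr0 => <-.
apply: (taylor01_node _ (node01 kn)); first by rewrite lexx ler01.
rewrite subr0 ger0_norm ?divr_ge0 //.
by rewrite ler_wpM2r ?ler_nat // ltW.
Qed.

Lemma round_error_right k : f 1 \is a Num.int -> deriv01 f 1 \is a Num.int ->
  (forall i, (2 <= i <= s)%N -> derivn01 i f 1 = 0) -> (k <= n)%N -> (n - k <= s)%N ->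
  `|coef_int n k - f (k%:R / n%:R)| <= W * (s%:R / n%:R) ^+ s.
Proof.
move=> f1 f'1 H kn ks; have ni0 : 0 < n%:R^-1 :> R by rewrite invr_gt0 ltr0n.
have nn0 : n%:R != 0 :> R by rewrite pnatr_eq0 -lt0n.
have E : k%:R / n%:R - 1 = - ((n - k)%:R / n%:R) :> R by rewrite natrB //; field.
have f'1N : - deriv01 f 1 \is a Num.int by rewrite rpredN.
(* The variable at 1 is [k / n - 1 = - (n - k) / n], so [binom_int] is used at [n - k] with slope
   [- f'(1)]. *)
have := binom_int n (n - k) f1 f'1N; rewrite bin_sub // mulNr -mulrN -E => I.
apply: le_trans (round_error kn I) _.
have := taylor01_collapse (k%:R / n%:R) H => <-.
apply: (taylor01_node _ (node01 kn)); first by rewrite lexx ler01.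
rewrite E normrN ger0_norm ?divr_ge0 //.
by rewrite ler_wpM2r ?ler_nat // ltW.
Qed.

End Modulus.

(** The coefficients split into the Taylor polynomial of [f] at [x = k / n], whose [s]-th difference
    is exactly [f^(s)(x) / n ^ s], and a remainder [r] of rounding and Taylor errors. [W] stays free
    so as to be either a Hölder bound or a multiple of [omega1]. *)
Lemma coef_estimate (G : R) :
  f 0 \is a Num.int -> f 1 \is a Num.int ->
  deriv01 f 0 \is a Num.int -> deriv01 f 1 \is a Num.int ->
  (forall i, (2 <= i <= s)%N -> derivn01 i f 0 = 0 /\ derivn01 i f 1 = 0) ->
  (forall t, 0 <= t <= 1 -> `|derivn01 s f t| <= G) ->
  exists2 c : R, 0 <= c & forall m k W, (0 < m)%N -> (k <= m)%N ->
    (forall t u, 0 <= t <= 1 -> 0 <= u <= 1 -> `|t - u| <= s%:R / (m + s)%:R ->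
      `|derivn01 s f t - derivn01 s f u| <= W) ->
    `|((m + s) ^_ s)%:R * iter s fdiff (coef_int (m + s)) k - derivn01 s f (k%:R / m%:R)|
      <= c * (W + (m + s)%:R^-1).
Proof.
move=> f0 f1 f'0 f'1 Hi HG; have G0 : 0 <= G by apply: le_trans (HG 0 _); rewrite ?lexx ?ler01.
pose c1 : R := s%:R ^+ s + (2 ^ s.+1 * (s.+1)`!)%:R.
have ss0 : 0 <= s%:R ^+ s :> R by rewrite exprn_ge0.
have c10 : 0 <= c1 by rewrite addr_ge0.
exists (G * s%:R ^+ 2 + 2 ^+ s * (c1 + s%:R ^+ s) + 1).
  by rewrite !addr_ge0 ?mulr_ge0 ?exprn_ge0 ?addr_ge0.
move=> m k W m0 km osc; set n := (m + s)%N in osc *.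
have n0 : (0 < n)%N by rewrite addn_gt0 m0.
have nr0 : 0 < n%:R :> R by rewrite ltr0n.
have ni0 : 0 < n%:R^-1 :> R by rewrite invr_gt0.
have P0 : 0 < n%:R ^+ s :> R by rewrite exprn_gt0.
have W0 : 0 <= W.
  by apply: le_trans (osc 0 0 _ _ _); rewrite ?subrr ?normr0 ?lexx ?ler01 // divr_ge0.
have WE : W * (s%:R / n%:R) ^+ s * n%:R ^+ s = W * s%:R ^+ s.
  by rewrite -mulrA -exprMn divfK // gt_eqF.
have round i : (i <= n)%N ->
    `|coef_int n i - f (i%:R / n%:R)| * n%:R ^+ s <= c1 * (W + n%:R^-1).
  move=> ni.
  have E1 : `|coef_int n i - f (i%:R / n%:R)| <= W * (s%:R / n%:R) ^+ s ->
      `|coef_int n i - f (i%:R / n%:R)| * n%:R ^+ s <= c1 * (W + n%:R^-1).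
    move=> H; apply: le_trans (ler_wpM2r (ltW P0) H) _.
    rewrite WE [c1 * _]mulrDr; apply: ler_wpDr; first by rewrite mulr_ge0 // ltW.
    by rewrite mulrC ler_wpM2r // lerDl.
  have [ik|ik] := leqP i s; first by apply: E1; apply: round_error_left => // j /Hi[].
  have [jk|jk] := leqP (n - i) s; first by apply: E1; apply: round_error_right => // j /Hi[].
  apply: le_trans (round_error_mid n0 ik jk) _; by rewrite ler_pM ?lerDr ?(ltW ni0).
have kn : (k <= n)%N by apply: leq_trans km (leq_addr _ _).
pose x : R := k%:R / n%:R; have x01 : 0 <= x <= 1 := node01 kn.
pose r i : R := coef_int n (k + i) - (taylor01 s f x).[(k + i)%:R / n%:R].
have rE i : (i <= s)%N -> `|r i| * n%:R ^+ s <= (c1 + s%:R ^+ s) * (W + n%:R^-1).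
  move=> si; have kin : (k + i <= n)%N by rewrite leq_add.
  have y01 : 0 <= ((k + i)%:R / n%:R : R) <= 1 := node01 kin.
  have yx : `|(k + i)%:R / n%:R - x| <= s%:R / n%:R.
    by rewrite /x natrD mulrDl addrAC subrr add0r ger0_norm ?divr_ge0 // ler_wpM2r ?ler_nat // ltW.
  have := taylor01_node osc x01 y01 yx.
  move=> /(ler_wpM2r (ltW P0)); rewrite WE => T.
  have C := round _ kin.
  have : `|r i| * n%:R ^+ s <= `|coef_int n (k + i) - f ((k + i)%:R / n%:R)| * n%:R ^+ s
     + `|f ((k + i)%:R / n%:R) - (taylor01 s f x).[(k + i)%:R / n%:R]| * n%:R ^+ s.
    rewrite -mulrDl ler_wpM2r ?(ltW P0) //; apply: le_trans (ler_normD _ _).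
    by rewrite addrA subrK.
  have : 0 <= s%:R ^+ s * n%:R^-1 :> R by rewrite mulr_ge0 // ltW.
  by rewrite mulrDl [s%:R ^+ s * (W + _)]mulrDr [s%:R ^+ s * W]mulrC => *; lra.
have D : iter s fdiff (coef_int n) k = derivn01 s f x / n%:R ^+ s + iter s fdiff r 0%N.
  rewrite -iter_fdiff_shift.
  have -> : (fun i => coef_int n (k + i)) = (fun i =>
      \sum_(l < s.+1) (derivn01 l f x / l`!%:R / n%:R ^+ l) * i%:R ^+ l + r i).
    apply/funext => i; rewrite /r taylor01_horner.
    have -> : \sum_(l < s.+1) derivn01 l f x / l`!%:R / n%:R ^+ l * i%:R ^+ l =
       \sum_(l < s.+1) derivn01 l f x / l`!%:R * ((k + i)%:R / n%:R - x) ^+ l.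
      apply: eq_bigr => l _; rewrite /x natrD mulrDl addrAC subrr add0r exprMn exprVn.
      by rewrite -mulrA [_^-1 * i%:R ^+ l]mulrC.
    by rewrite addrC subrK.
  rewrite iter_fdiffD iter_fdiff_sum big_ord_recr /= big1 => [|l _]; last first.
    by rewrite iter_fdiff_exprn ?(ltnW (ltn_ord l)) // (ltn_eqF (ltn_ord l)) mul0r mulr0.
  rewrite add0r iter_fdiff_exprn // eqxx mul1r; congr (_ + _).
  by rewrite mulrAC divfK // pnatr_eq0 -lt0n fact_gt0.
have [F1 F2] := @ffact_ratio R n s (leq_addl _ _).
set F : R := (n ^_ s)%:R in F1 F2 *.
have F0 : 0 <= F by [].
(* Three errors: the difference of [r], the falling factorial in place of [n ^ s] ([b2]), and
   [k / n] in place of [k / m] ([b3]). *)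
have b1 : `|F * iter s fdiff r 0%N| <= 2 ^+ s * ((c1 + s%:R ^+ s) * (W + n%:R^-1)).
  rewrite normrM ger0_norm //.
  apply: (@le_trans _ _ (n%:R ^+ s * `|iter s fdiff r 0%N|)); first by rewrite ler_wpM2r.
  rewrite mulrC -ler_pdivlMr // -mulrA; apply: norm_iter_fdiff => i si.
  by rewrite add0n ler_pdivlMr //; exact: rE.
have b2 : `|F * (derivn01 s f x / n%:R ^+ s) - derivn01 s f x| <= G * s%:R ^+ 2 * n%:R^-1.
  have -> : F * (derivn01 s f x / n%:R ^+ s) - derivn01 s f x =
     - (derivn01 s f x * (1 - F / n%:R ^+ s)) by field; rewrite gt_eqF.
  rewrite normrN normrM -mulrA ler_pM ?HG //.
  rewrite ger0_norm ?subr_ge0 ?ler_pdivrMr ?mul1r //.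
  by rewrite lerBlDr -lerBlDl ler_pdivlMr.
have b3 : `|derivn01 s f x - derivn01 s f (k%:R / m%:R)| <= W.
  apply: osc => //; first exact: node01.
  have mr0 : 0 < m%:R :> R by rewrite ltr0n.
  have -> : x - k%:R / m%:R = - (k%:R / m%:R * (s%:R / n%:R)).
    by rewrite /x /n natrD; field; rewrite -natrD !gt_eqF.
  rewrite normrN normrM [X in _ * X]ger0_norm ?divr_ge0 // ler_piMl ?divr_ge0 //.
  by have /andP[? ?] : 0 <= (k%:R / m%:R : R) <= 1 := node01 km; rewrite ger0_norm.
rewrite D mulrDr.
have -> : F * (derivn01 s f x / n%:R ^+ s) + F * iter s fdiff r 0%N - derivn01 s f (k%:R / m%:R) =
   (F * (derivn01 s f x / n%:R ^+ s) - derivn01 s f x) +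
   (derivn01 s f x - derivn01 s f (k%:R / m%:R)) + F * iter s fdiff r 0%N by ring.
apply: le_trans (ler_normD _ _) _.
have := ler_normD (F * (derivn01 s f x / n%:R ^+ s) - derivn01 s f x)
  (derivn01 s f x - derivn01 s f (k%:R / m%:R)).
have : 0 <= G * s%:R ^+ 2 * W by rewrite !mulr_ge0 ?exprn_ge0.
by move=> *; lra.
Qed.

End RoundedCoefficients.

(** * Moduli of smoothness *)

Section Suprema.
Context {R : realType}.
Implicit Types (g F : R -> R) (x y t h u B G al M : R).

Lemma continuous01_bounded g : {within `[0, 1], continuous g} ->
  exists2 G : R, 0 <= G & forall t, 0 <= t <= 1 -> `|g t| <= G.
Proof.
move=> cg; have /compact_bounded[B [_ /(_ (`|B| + 1))]] :
    compact (g @` `[(0 : R), 1]) by apply: continuous_compact cg (@segment_compact R _ _).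
have -> : B < `|B| + 1 by rewrite ltr_pwDr ?ler_norm.
move=> /(_ isT) H; exists (`|B| + 1); first by rewrite addr_ge0.
by move=> t t01; apply: H => /=; exists t => //=; rewrite in_itv.
Qed.

(** The bound [B] guards against the value 0 that [sup] takes on unbounded sets. *)
Lemma norm01_ge g x B : (forall y, 0 <= y <= 1 -> `|g y| <= B) -> 0 <= x <= 1 ->
  `|g x| <= norm01 g.
Proof.
move=> gB x01; apply: ub_le_sup.
  by exists B => _ [y + <-]; rewrite /= in_itv => /gB.
by exists x => //=; rewrite in_itv.
Qed.

Lemma norm01_le g B : (forall y, 0 <= y <= 1 -> `|g y| <= B) -> norm01 g <= B.
Proof.
move=> gB; apply: ge_sup; last by move=> _ [y + <-]; rewrite /= in_itv => /gB.
by exists `|g 0|; exists 0 => //=; rewrite in_itv /= lexx ler01.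
Qed.

Lemma norm01_ge0 g : 0 <= norm01 g.
Proof.
rewrite /norm01; have [/sup_out -> //|hs] := pselect (~ has_sup [set `|g x| | x in `[0, 1]]).
move/contrapT : hs => hs; apply: (@le_trans _ _ `|g 0|) => //.
by apply: (ub_le_sup hs.2); exists 0 => //=; rewrite in_itv /= lexx ler01.
Qed.

Lemma omega1_ge g x y t B : (forall u, 0 <= u <= 1 -> `|g u| <= B) ->
  0 <= x <= 1 -> 0 <= y <= 1 -> `|x - y| <= t -> `|g x - g y| <= omega1 g t.
Proof.
move=> gB x01 y01 xy; apply: ub_le_sup; last by exists (x, y).
exists (B + B) => _ [p /= [p1 p2 _] <-].
by apply: le_trans (ler_normB _ _) _; rewrite lerD ?gB.
Qed.

Lemma omega1_le g t B : 0 <= t ->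
  (forall x y, 0 <= x <= 1 -> 0 <= y <= 1 -> `|x - y| <= t -> `|g x - g y| <= B) ->
  omega1 g t <= B.
Proof.
move=> t0 gB; apply: ge_sup; last by move=> _ [p /= [p1 p2 p12] <-]; exact: gB.
exists `|g 0 - g 0|; exists (0, 0) => //=; split; rewrite ?lexx ?ler01 //.
by rewrite subrr normr0.
Qed.

(** Go from [y] to [x] in [k] equal steps of length at most [t], inside [[0, 1]] by convexity. *)
Lemma omega1_mulrn g x y t k B : (forall u, 0 <= u <= 1 -> `|g u| <= B) ->
  0 <= x <= 1 -> 0 <= y <= 1 -> `|x - y| <= k%:R * t ->
  `|g x - g y| <= k%:R * omega1 g t.
Proof.
move=> gB x01 y01; have [->|k0] := posnP k.
  rewrite mul0r normr_le0 subr_eq0 => /eqP ->.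
  by rewrite subrr normr0 mul0r.
move=> xy; have kr0 : 0 < k%:R :> R by rewrite ltr0n.
pose z i := y + i%:R * ((x - y) / k%:R).
have z01 i : (i <= k)%N -> 0 <= z i <= 1.
  move=> ik; have i1 : i%:R / k%:R <= 1 :> R by rewrite ler_pdivrMr // mul1r ler_nat.
  have i0 : 0 <= i%:R / k%:R :> R by rewrite divr_ge0.
  have -> : z i = i%:R / k%:R * x + (1 - i%:R / k%:R) * y.
    by rewrite /z; field; rewrite gt_eqF.
  move: x01 y01 i0 i1; move: (_ / _) => w /andP[? ?] /andP[? ?] ? ?.
  by apply/andP; split; nra.
have step i : (i < k)%N -> `|g (z i.+1) - g (z i)| <= omega1 g t.
  move=> ik; apply: (omega1_ge gB); rewrite ?z01 // 1?ltnW //.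
  have -> : z i.+1 - z i = (x - y) / k%:R by rewrite /z -natr1; ring.
  by rewrite normrM normfV (gtr0_norm kr0) ler_pdivrMr // mulrC.
have {step} H i : (i <= k)%N -> `|g (z i) - g y| <= i%:R * omega1 g t.
  elim: i => [|i IH] ik; first by rewrite /z !mul0r addr0 subrr normr0.
  rewrite -natr1 mulrDl mul1r.
  have -> : g (z i.+1) - g y = (g (z i) - g y) + (g (z i.+1) - g (z i)) by ring.
  apply: le_trans (ler_normD _ _) _.
  by rewrite lerD ?step // IH // ltnW.
have zk : z k = x by rewrite /z mulrC divfK ?gt_eqF // addrC subrK.
by have := H k (leqnn k); rewrite zk.
Qed.

Lemma diff2_phi_le g h x B : (forall u, 0 <= u <= 1 -> `|g u| <= B) -> 0 <= x <= 1 ->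
  `|diff2_phi g h x| <= 4 * B.
Proof.
move=> gB x01; have B0 : 0 <= B by apply: le_trans (gB x x01).
rewrite /diff2_phi; case: ifP => [/andP[a b]|_]; last by rewrite normr0 mulr_ge0.
move: (gB _ a) (gB _ b) (gB _ x01); rewrite !ler_norml => *; lra.
Qed.

Lemma omega2_phi_ge g h t x B : (forall u, 0 <= u <= 1 -> `|g u| <= B) ->
  0 < h <= t -> 0 <= x <= 1 -> `|diff2_phi g h x| <= omega2_phi g t.
Proof.
move=> gB ht x01; apply: (@le_trans _ _ (norm01 (diff2_phi g h))).
  by apply: (@norm01_ge _ _ (4 * B)) => // y y01; exact: diff2_phi_le.
apply: ub_le_sup; last by exists h => //=; rewrite in_itv.
exists (4 * B) => _ [k _ <-]; apply: norm01_le => y y01; exact: diff2_phi_le.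
Qed.

Lemma omega2_phi_le g t B : 0 < t ->
  (forall h x, 0 < h <= t -> 0 <= x <= 1 -> `|diff2_phi g h x| <= B) ->
  omega2_phi g t <= B.
Proof.
move=> t0 H; apply: ge_sup.
  by exists (norm01 (diff2_phi g t)); exists t => //=; rewrite in_itv /= t0 lexx.
move=> z [h /=]; rewrite in_itv /= => ht <-; apply: norm01_le => x; exact: H.
Qed.

Lemma omega1_ge0 g t : 0 <= omega1 g t.
Proof.
rewrite /omega1; set E := (X in sup X).
have [/sup_out -> //|hs] := pselect (~ has_sup E).
move/contrapT : hs => hs; have [_ [p Ep _]] := hs.1.
apply: (@le_trans _ _ `|g p.1 - g p.2|) => //.
by apply: (ub_le_sup hs.2); exists p.
Qed.

Lemma omega2_phi_ge0 g t : 0 <= omega2_phi g t.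
Proof.
rewrite /omega2_phi; set E := (X in sup X).
have [/sup_out -> //|hs] := pselect (~ has_sup E).
move/contrapT : hs => hs; have [_ [h Eh _]] := hs.1.
apply: (@le_trans _ _ (norm01 (diff2_phi g h))); first exact: norm01_ge0.
by apply: (ub_le_sup hs.2); exists h.
Qed.

Lemma eqO_at_right0P F al : (forall h, 0 < h -> 0 <= F h) ->
  (F =O_ (0^'+) (fun h : R => h `^ al)) <->
  exists2 C : R, 0 <= C & exists2 d : R, 0 < d & forall h, 0 < h < d -> F h <= C * h `^ al.
Proof.
move=> F0; split.
  move=> /eqO_exP[C C0]; rewrite /= => /nbhs_ballP[d /= d0 Hd].
  exists C; first exact: ltW.
  exists d => // h /andP[h0 hd]; have := Hd h; rewrite /ball /= sub0r normrN gtr0_norm //.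
  by move=> /(_ hd h0); rewrite !ger0_norm ?powR_ge0 ?F0.
move=> [C C0 [d d0 H]]; apply/eqO_exP; exists (C + 1); first by rewrite ltr_wpDl.
apply/nbhs_ballP; exists d => //= h; rewrite /ball /= sub0r normrN => hd h0.
rewrite gtr0_norm // in hd; rewrite !ger0_norm ?powR_ge0 ?F0 //.
apply: le_trans (H h _) _; first by rewrite h0.
by rewrite ler_wpM2r ?powR_ge0 // lerDl.
Qed.

Lemma eqO_natP (u : nat -> R) al : (forall n, 0 <= u n) ->
  (u =O_ \oo (fun n : nat => n%:R `^ (- al))) <->
  exists2 C : R, 0 <= C & exists N : nat, forall n, (N <= n)%N -> u n <= C * n%:R `^ (- al).
Proof.
move=> u0; split.
  move=> /eqO_exP[C C0]; rewrite /= => -[N _ HN]; exists C; first exact: ltW.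
  by exists N => n Nn; have := HN n Nn; rewrite /= !ger0_norm ?powR_ge0.
move=> [C C0 [N H]]; apply/eqO_exP; exists (C + 1); first by rewrite ltr_wpDl.
exists N => // n /= Nn; rewrite !ger0_norm ?powR_ge0 //.
by apply: le_trans (H n Nn) _; rewrite ler_wpM2r ?powR_ge0 // lerDl.
Qed.

End Suprema.

Section Moduli.
Context {R : realType}.
Variables (g : R -> R) (al G : R).
Hypothesis al0 : 0 < al.
Hypothesis G0 : 0 <= G.
Hypothesis gG : forall t, 0 <= t <= 1 -> `|g t| <= G.

Lemma powR_mul2 h : 0 <= h -> h `^ (2 * al) = (h ^+ 2) `^ al.
Proof. by move=> h0; rewrite powRrM powR_mulrn. Qed.

Lemma powR_ge_scale (d h be : R) : 0 < d -> d <= h -> 0 < be -> 1 <= d `^ (- be) * h `^ be.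
Proof.
move=> d0 dh b0; rewrite powRN mulrC ler_pdivlMr ?powR_gt0 // mul1r.
by rewrite ge0_ler_powR ?(ltW b0) // nnegrE ?(ltW d0) // (le_trans (ltW d0)).
Qed.

(** At distances below [d] the O-bound applies with [h = |x - y|]; beyond, [2 G] is at most
    [2 G (|x - y| / d) ^ al]. *)
Lemma omega1_holder :
  (omega1 g =O_ (0^'+) (fun h : R => h `^ al)) <->
  exists2 M : R, 0 <= M &
    forall x y, 0 <= x <= 1 -> 0 <= y <= 1 -> `|g x - g y| <= M * `|x - y| `^ al.
Proof.
split; last first.
  move=> [M M0 H]; apply/eqO_at_right0P; first by move=> *; exact: omega1_ge0.
  exists M => //; exists 1 => // h /andP[h0 h1]; apply: omega1_le; first exact: ltW.
  move=> x y x01 y01 xy; apply: le_trans (H x y x01 y01) _; rewrite ler_wpM2l //.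
  by rewrite ge0_ler_powR ?(ltW al0) ?nnegrE // ltW.
move=> /eqO_at_right0P[|C C0 [d d0 H]]; first by move=> *; exact: omega1_ge0.
exists (C + (G + G) * d `^ (- al)); first by rewrite addr_ge0 // mulr_ge0 ?addr_ge0 ?powR_ge0.
move=> x y x01 y01; rewrite mulrDl.
have CC : 0 <= C * `|x - y| `^ al by rewrite mulr_ge0 // powR_ge0.
have [->|xNy] := eqVneq x y.
  by rewrite subrr normr0 addr_ge0 // !mulr_ge0 ?addr_ge0 ?powR_ge0.
have h0 : 0 < `|x - y| by rewrite normr_gt0 subr_eq0.
have [hd|hd] := ltP `|x - y| d.
  apply: ler_wpDr; first by rewrite !mulr_ge0 ?addr_ge0 ?powR_ge0.
  by apply: le_trans (omega1_ge gG x01 y01 (lexx _)) _; apply: H; rewrite h0.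
apply: ler_wpDl => //; apply: le_trans (ler_normB _ _) _.
apply: (@le_trans _ _ (G + G)); first by rewrite lerD ?gG.
by rewrite -mulrA ler_peMr ?addr_ge0 // powR_ge_scale.
Qed.

(** The substitution [u = h phi(y)] gives [h ^ 2 = u ^ 2 / (y (1 - y))]; for [h >= d] the bound
    [4 G] is absorbed as in [omega1_holder]. *)
Lemma omega2_zygmund :
  (omega2_phi g =O_ (0^'+) (fun h : R => h `^ (2 * al))) <->
  exists2 M : R, 0 <= M &
    forall y u, 0 < y < 1 -> 0 < u -> 0 <= y - u -> y + u <= 1 ->
      `|g (y + u) - g y *+ 2 + g (y - u)| <= M * (u ^+ 2 / (y * (1 - y))) `^ al.
Proof.
have al20 : 0 < 2 * al by rewrite mulr_gt0.
split; last first.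
  move=> [M M0 H]; apply/eqO_at_right0P; first by move=> *; exact: omega2_phi_ge0.
  exists M => //; exists 1 => // t /andP[t0 t1]; apply: omega2_phi_le => // h x /andP[h0 ht] x01.
  have /andP[x0 x1] := x01.
  apply: (@le_trans _ _ (M * h `^ (2 * al))); last first.
    by rewrite ler_wpM2l // ge0_ler_powR ?(ltW al20) // nnegrE ltW.
  have RH0 : 0 <= M * h `^ (2 * al) by rewrite mulr_ge0 // powR_ge0.
  rewrite /diff2_phi; case: ifP => [/andP[/andP[a b] /andP[c d]]|_]; last by rewrite normr0.
  have [r0|r0] := eqVneq (x * (1 - x)) 0.
    rewrite /phi r0 sqrtr0 mulr0 addr0 subr0.
    have -> : g x - g x *+ 2 + g x = 0 by ring.
    by rewrite normr0.
  have x00 : 0 < x by rewrite lt_neqAle x0 andbT eq_sym; apply: contraNneq r0 => ->; rewrite mul0r.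
  have x10 : x < 1.
    rewrite lt_neqAle x1 andbT; apply: contraNneq r0 => ->.
    by rewrite subrr mulr0.
  have rr0 : 0 < x * (1 - x) by rewrite mulr_gt0 // subr_gt0.
  have p0 : 0 < phi x by rewrite sqrtr_gt0.
  apply: le_trans (H x (h * phi x) _ _ c b) _; rewrite ?x00 ?mulr_gt0 //.
  rewrite ler_wpM2l // powR_mul2 ?(ltW h0) // exprMn sqr_sqrtr ?(ltW rr0) //.
  by rewrite mulfK // gt_eqF.
move=> /eqO_at_right0P[|C C0 [d d0 H]]; first by move=> *; exact: omega2_phi_ge0.
exists (C + 4 * G * d `^ (- (2 * al))).
  by rewrite addr_ge0 // !mulr_ge0 ?powR_ge0.
move=> y u y01 u0 yu uy; have /andP[y0 y1] := y01.
have y01' : 0 <= y <= 1 by rewrite !ltW.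
have rr0 : 0 < y * (1 - y) by rewrite mulr_gt0 // subr_gt0.
have p0 : 0 < phi y by rewrite sqrtr_gt0.
pose h := u / phi y; have h0 : 0 < h by rewrite divr_gt0.
have hE : h * phi y = u by rewrite divfK // gt_eqF.
have DE : diff2_phi g h y = g (y + u) - g y *+ 2 + g (y - u).
  rewrite /diff2_phi hE ifT // yu uy addr_ge0 ?(ltW y0) ?(ltW u0) //=; lra.
have -> : (u ^+ 2 / (y * (1 - y))) `^ al = h `^ (2 * al).
  rewrite powR_mul2 ?(ltW h0) //; congr (_ `^ _).
  by rewrite exprMn exprVn sqr_sqrtr // ltW.
rewrite -DE mulrDl.
have CC : 0 <= C * h `^ (2 * al) by rewrite mulr_ge0 // powR_ge0.
have [hd|hd] := ltP h d.
  apply: ler_wpDr; first by rewrite !mulr_ge0 ?powR_ge0.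
  apply: le_trans (@omega2_phi_ge R g h h y G gG _ y01') _; first by rewrite h0 lexx.
  by apply: H; rewrite h0.
apply: ler_wpDl => //; apply: le_trans (diff2_phi_le h gG y01') _.
by rewrite -mulrA ler_peMr ?mulr_ge0 // powR_ge_scale.
Qed.

End Moduli.

(** * Rates for derivatives of integer Bernstein polynomials *)

Lemma bern_lipschitz (R : realType) m (b : nat -> R) (e x y : R) :
  0 <= e -> 0 <= x <= 1 -> 0 <= y <= 1 ->
  (forall k, (k < m)%N -> `|b k.+1 - b k| <= e) ->
  `|(bern m b).[x] - (bern m b).[y]| <= m%:R * e * `|x - y|.
Proof.
move=> e0 x01 y01 be.
apply: (@mean_value01 R (horner (bern m b)) (horner (bern m b)^`())) => //.
  by move=> t t01; exact: is_deriv01_poly.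
move=> t t01 _; case: m be => [|m] be; first by rewrite /= derivC horner0 normr0 mul0r.
rewrite deriv_bern hornerM hornerC normrM ger0_norm // ler_wpM2l //.
by apply: norm_bern_le => // k km; exact: be.
Qed.

Lemma natr_powRN_ge (R : realType) (n : nat) (al : R) : (0 < n)%N -> al <= 1 ->
  n%:R^-1 <= n%:R `^ (- al) :> R.
Proof.
move=> n0 al1; rewrite powRN lef_pV2 ?posrE ?powR_gt0 ?ltr0n //.
by rewrite ler1_powR // ler1n.
Qed.

Lemma natr_powRN_le (R : realType) (m n : nat) (al : R) : (0 < m)%N -> (m <= n)%N ->
  0 <= al -> n%:R `^ (- al) <= m%:R `^ (- al).
Proof.
move=> m0 mn al0; have n0 : (0 < n)%N by apply: leq_trans mn.
rewrite !powRN lef_pV2 ?posrE ?powR_gt0 ?ltr0n //.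
by rewrite ge0_ler_powR ?nnegrE // ler_nat.
Qed.

Lemma natr_powRN_mul (R : realType) (k m : nat) (al : R) : (0 < k)%N -> al <= 1 ->
  m%:R `^ (- al) <= k%:R * (k * m)%:R `^ (- al).
Proof.
move=> k0 al1; rewrite natrM powRM // mulrA ler_peMl ?powR_ge0 //.
by rewrite powRN ler_pdivlMr ?powR_gt0 ?ltr0n // mul1r ler1_powR // ler1n.
Qed.

Lemma leq_split s k n : (s + k <= n)%N -> exists2 m, n = (m + s)%N & (k <= m)%N.
Proof. by move=> skn; exists (n - s)%N; lia. Qed.

Section Rates.
Context {R : realType}.
Variables (rnd : R -> int) (s : nat) (al : R) (f : R -> R) (G c : R).
Let g := derivn01 s f.
Let P n := derivn01 s (bernstein_int rnd n f).
Let B m := bern m (fun k => g (k%:R / m%:R)).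
Hypothesis s0 : (0 < s)%N.
Hypothesis al0 : 0 < al.
Hypothesis al1 : al < 1.
Hypothesis G0 : 0 <= G.
Hypothesis gG : forall t, 0 <= t <= 1 -> `|g t| <= G.
Hypothesis c0 : 0 <= c.
Let a n k : R := (n ^_ s)%:R * iter s fdiff (coef_int rnd f n) k.
Hypothesis coefH : forall m k W, (0 < m)%N -> (k <= m)%N ->
  (forall t u, 0 <= t <= 1 -> 0 <= u <= 1 -> `|t - u| <= s%:R / (m + s)%:R ->
     `|g t - g u| <= W) ->
  `|a (m + s) k - g (k%:R / m%:R)| <= c * (W + (m + s)%:R^-1).
Implicit Types (m n k : nat) (x y t u W M C : R).

Lemma derivn_bernstein_int m x : 0 <= x <= 1 -> P (m + s) x = (bern m (a (m + s))).[x].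
Proof.
move=> x01; rewrite /P (@derivn01_poly R _ (bern (m + s) (coef_int rnd f (m + s))) s) //.
  by rewrite derivn_bern ?leq_addl // addnK bernZ.
by move=> y _; exact: bernstein_intE.
Qed.

Lemma bernstein_int_bern m x W : (0 < m)%N -> 0 <= x <= 1 ->
  (forall t u, 0 <= t <= 1 -> 0 <= u <= 1 -> `|t - u| <= s%:R / (m + s)%:R ->
     `|g t - g u| <= W) ->
  `|P (m + s) x - (B m).[x]| <= c * (W + (m + s)%:R^-1).
Proof.
move=> m0 x01 H; rewrite derivn_bernstein_int // -hornerN -hornerD -bernB.
by apply: norm_bern_le => // k km; exact: coefH.
Qed.

Lemma holder_osc M n t u : 0 <= M ->
  (forall x y, 0 <= x <= 1 -> 0 <= y <= 1 -> `|g x - g y| <= M * `|x - y| `^ al) ->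
  (0 < n)%N -> 0 <= t <= 1 -> 0 <= u <= 1 -> `|t - u| <= s%:R / n%:R ->
  `|g t - g u| <= M * s%:R * n%:R `^ (- al).
Proof.
move=> M0 H n0 t01 u01 tu; apply: le_trans (H t u t01 u01) _.
rewrite -mulrA ler_wpM2l //; apply: (@le_trans _ _ ((s%:R / n%:R) `^ al)).
  by rewrite ge0_ler_powR ?(ltW al0) // nnegrE // divr_ge0.
rewrite powRM ?invr_ge0 // -powR_inv1 // -powRrM mulN1r ler_wpM2r ?powR_ge0 //.
by rewrite ler1_powR ?(ltW al1) // ler1n.
Qed.

Lemma bernstein_int_bern_holder M : 0 <= M ->
  (forall x y, 0 <= x <= 1 -> 0 <= y <= 1 -> `|g x - g y| <= M * `|x - y| `^ al) ->
  forall m x, (0 < m)%N -> 0 <= x <= 1 ->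
  `|P (m + s) x - (B m).[x]| <= c * (M * s%:R + 1) * (m + s)%:R `^ (- al).
Proof.
move=> M0 H m x m0 x01; have n0 : (0 < m + s)%N by rewrite addn_gt0 m0.
apply: le_trans (bernstein_int_bern m0 x01 (fun t u => @holder_osc M _ t u M0 H n0)) _.
rewrite -[leRHS]mulrA ler_wpM2l // mulrDl mul1r lerD2l.
exact: natr_powRN_ge n0 (ltW al1).
Qed.

Lemma direct_rate :
  omega2_phi g =O_ (0^'+) (fun h : R => h `^ (2 * al)) ->
  omega1 g =O_ (0^'+) (fun h : R => h `^ al) ->
  (fun n : nat => norm01 (P n \- g)) =O_ \oo (fun n : nat => n%:R `^ (- al)).
Proof.
move=> /(omega2_zygmund al0 G0 gG)[M2 M20 H2] /(omega1_holder al0 G0 gG)[M1 M10 H1].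
apply/eqO_natP; first by move=> n; exact: norm01_ge0.
pose M := M1 + M2; have M0 : 0 <= M by rewrite addr_ge0.
exists (c * (M1 * s%:R + 1) + 48 * M).
  by rewrite addr_ge0 ?mulr_ge0 ?addr_ge0 ?mulr_ge0.
(* Then [m = n - s > s], so [n <= 2 m] and the rate in [m] is at most twice that in [n]: hence
   [48 = 2 * 24]. *)
exists (s + s.+1)%N => n /leq_split[m nE m0].
have m1 : (0 < m)%N by apply: leq_ltn_trans m0.
rewrite nE; apply: norm01_le => x x01.
have h1 := bernstein_int_bern_holder M10 H1 m1 x01.
have h2 : `|(B m).[x] - g x| <= 24 * M * m%:R `^ (- al).
  apply: bern_direct => //; first by rewrite al0 ltW.
    move=> u v u01 v01; apply: le_trans (H1 _ _ u01 v01) _.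
    by rewrite ler_wpM2r ?powR_ge0 // lerDl.
  move=> y u y01; rewrite le_eqVlt => /predU1P[<- _ _|u0 yu uy].
    rewrite addr0 subr0; have -> : g y - g y *+ 2 + g y = 0 by ring.
    by rewrite normr0 mulr_ge0 // powR_ge0.
  apply: le_trans (H2 _ _ y01 u0 yu uy) _.
  by rewrite ler_wpM2r ?powR_ge0 // lerDr.
have h3 : m%:R `^ (- al) <= 2 * (m + s)%:R `^ (- al).
  apply: le_trans (natr_powRN_mul m (isT : (0 < 2)%N) (ltW al1)) _.
  rewrite ler_wpM2l //; apply: natr_powRN_le (ltW al0); first by rewrite addn_gt0 m1.
  by rewrite mul2n -addnn leq_add2l ltnW.
have h4 : 24 * M * m%:R `^ (- al) <= 24 * M * (2 * (m + s)%:R `^ (- al)).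
  by rewrite ler_wpM2l // mulr_ge0.
have -> : (P (m + s) \- g) x = (P (m + s) x - (B m).[x]) + ((B m).[x] - g x).
  by rewrite addrA subrK.
by apply: le_trans (ler_normD _ _) _; rewrite mulrDl; lra.
Qed.

(** [g] is [E]-close to [P (m + s)], whose Lipschitz constant is at most [m] times the largest gap
    between consecutive coefficients; by [coefH] the gaps are [O(omega1 g (1 / n) + 1 / n)]. *)
Lemma modulus_step m h (E : R) : (s <= m)%N -> 0 < h ->
  (forall x, 0 <= x <= 1 -> `|P (m + s) x - g x| <= E) ->
  omega1 g h <= E *+ 2 + (2 * c * (s%:R + 1) + 2) * h * (m + s)%:R
     * (omega1 g (m + s)%:R^-1 + (m + s)%:R^-1).
Proof.
move=> sm h0 HE; set n := (m + s)%N in HE *.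
have m0 : (0 < m)%N by apply: leq_trans sm.
have n0 : (0 < n)%N by rewrite addn_gt0 m0.
have nr0 : 0 < n%:R :> R by rewrite ltr0n.
set q : R := n%:R^-1; have q0 : 0 < q by rewrite invr_gt0.
set O := omega1 g q; have O0 : 0 <= O by exact: omega1_ge0.
apply: omega1_le => [|x y x01 y01 xy]; first exact: ltW.
have osc t u : 0 <= t <= 1 -> 0 <= u <= 1 -> `|t - u| <= s%:R / n%:R ->
    `|g t - g u| <= s%:R * O.
  by move=> t01 u01; exact: omega1_mulrn gG t01 u01.
have step k : (k < m)%N ->
    `|a n k.+1 - a n k| <= (2 * c * (s%:R + 1) + 2) * (O + q).
  move=> km; have A1 := @coefH m k.+1 _ m0 km osc; have A2 := @coefH m k _ m0 (ltnW km) osc.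
  (* Since [s <= m], the spacing [1 / m] is at most [2 / n]. *)
  have A3 : `|g (k.+1%:R / m%:R) - g (k%:R / m%:R)| <= 2%:R * O.
    apply: (omega1_mulrn gG); rewrite ?node01 // 1?ltnW //.
    have mr0 : 0 < m%:R :> R by rewrite ltr0n.
    have -> : k.+1%:R / m%:R - k%:R / m%:R = m%:R^-1 :> R.
      by rewrite -mulrBl -natr1 addrAC subrr add0r mul1r.
    rewrite ger0_norm ?invr_ge0 ?(ltW mr0) // /q ler_pdivlMr // mulrC ler_pdivrMr //.
    by rewrite -natrM ler_nat mul2n -addnn leq_add2l.
  have -> : a n k.+1 - a n k = (a n k.+1 - g (k.+1%:R / m%:R)) +
     (g (k.+1%:R / m%:R) - g (k%:R / m%:R)) - (a n k - g (k%:R / m%:R)) by ring.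
  apply: le_trans (ler_normB _ _) _.
  have := ler_normD (a n k.+1 - g (k.+1%:R / m%:R)) (g (k.+1%:R / m%:R) - g (k%:R / m%:R)).
  rewrite -/n -/q in A1 A2.
  have : c * (s%:R * O + q) <= c * ((s%:R + 1) * (O + q)).
    rewrite ler_wpM2l //.
    have : 0 <= s%:R * q by rewrite mulr_ge0 // ltW.
    by lra.
  by move=> *; lra.
have K0 : 0 <= (2 * c * (s%:R + 1) + 2) * (O + q).
  by rewrite mulr_ge0 ?addr_ge0 ?mulr_ge0 ?(ltW q0).
have L := bern_lipschitz K0 x01 y01 step.
rewrite -!derivn_bernstein_int // -/n in L.
have := HE x x01; have := HE y y01.
have : `|g x - g y| <= `|P n x - P n y| + `|P n x - g x| + `|P n y - g y|.
  have -> : g x - g y = (P n x - P n y) - (P n x - g x) + (P n y - g y) by ring.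
  apply: le_trans (ler_normD _ _) _; rewrite lerD2r.
  exact: ler_normB.
have : m%:R * ((2 * c * (s%:R + 1) + 2) * (O + q)) * `|x - y|
    <= (2 * c * (s%:R + 1) + 2) * h * n%:R * (O + q).
  have -> : (2 * c * (s%:R + 1) + 2) * h * n%:R * (O + q) =
    n%:R * ((2 * c * (s%:R + 1) + 2) * (O + q)) * h by ring.
  have mn : m%:R <= n%:R :> R by rewrite ler_nat leq_addr.
  rewrite ler_pM //; first by rewrite mulr_ge0.
  by rewrite ler_wpM2r.
by move=> *; lra.
Qed.

(** The Hölder bound comes first, by [modulus_step] and [modulus_inverse]: comparing [P] with [B] at
    the required rate uses it. Then [bern_inverse] applies to [B]. *)
Lemma inverse_rate : {within `[0, 1], continuous g} ->
  (fun n : nat => norm01 (P n \- g)) =O_ \oo (fun n : nat => n%:R `^ (- al)) ->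
  omega2_phi g =O_ (0^'+) (fun h : R => h `^ (2 * al)) /\
  omega1 g =O_ (0^'+) (fun h : R => h `^ al).
Proof.
move=> cg /eqO_natP[|C C0 [N HN]]; first by move=> n; exact: norm01_ge0.
have HP m x : (N <= m + s)%N -> 0 <= x <= 1 ->
    `|P (m + s) x - g x| <= C * (m + s)%:R `^ (- al).
  move=> Nm x01; apply: le_trans (HN _ Nm).
  (* [norm01] dominates the pointwise values once the function is known to be bounded; on [[0, 1]],
     [P (m + s)] is a polynomial. *)
  have [Q Q0 HQ] : exists2 Q, 0 <= Q & forall x, 0 <= x <= 1 -> `|P (m + s) x| <= Q.
    have [Q Q0 HQ] := @continuous01_bounded R (horner (bern m (a (m + s))))
      (continuous_subspaceT (@continuous_horner R _)).
    by exists Q => // t t01; rewrite derivn_bernstein_int // HQ.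
  apply: (@norm01_ge R (P (m + s) \- g) x (Q + G)) => // y y01 /=.
  by apply: le_trans (ler_normB _ _) _; rewrite lerD ?HQ ?gG.
have O1 : omega1 g =O_ (0^'+) (fun h : R => h `^ al).
  have [M M0 HM] : exists2 M, 0 <= M & forall h, 0 < h <= 1 -> omega1 g h <= M * h `^ al.
    (* The starting index gives [m >= N + s], so both [s <= m] and [N <= m + s] hold. *)
    apply: (@modulus_inverse R (omega1 g) al (C *+ 2) (2 * c * (s%:R + 1) + 2) (G + G)
      (s + (N + s))%N) => //.
    - by rewrite al0.
    - by rewrite mulrn_wge0.
    - by rewrite !addr_ge0 ?mulr_ge0 ?addr_ge0.
    - by rewrite addn_gt0 s0.
    - move=> h t /andP[h0 ht]; apply: omega1_le; first exact: ltW.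
      by move=> x y x01 y01 xy; apply: (omega1_ge gG) => //; exact: le_trans ht.
    - move=> t t0; rewrite omega1_ge0 /=; apply: omega1_le; first exact: ltW.
      by move=> x y x01 y01 _; apply: le_trans (ler_normB _ _) _; rewrite lerD ?gG.
    - move=> n h /leq_split[m nE Nm] h0; rewrite nE [C *+ 2 * _]mulrnAl.
      apply: modulus_step => // [|x x01]; first exact: leq_trans (leq_addl _ _) Nm.
      by apply: HP => //; rewrite (leq_trans (leq_addr s N)) // (leq_trans Nm) // leq_addr.
  apply/eqO_at_right0P; first by move=> *; exact: omega1_ge0.
  by exists M => //; exists 1 => // h /andP[h0 h1]; apply: HM; rewrite h0 ltW.
split=> //.
have [M M0 H1] := (omega1_holder al0 G0 gG).1 O1.
apply/(omega2_zygmund al0 G0 gG).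
apply: (@bern_inverse R g al (C + c * (M * s%:R + 1) + (G + G) * N%:R) G) => //.
- by rewrite al0.
- by rewrite !addr_ge0 ?mulr_ge0 ?addr_ge0 ?mulr_ge0.
move=> m x m0 x01; rewrite -/(B m).
have p0 : 0 <= m%:R `^ (- al) := powR_ge0 _ _.
(* For degrees below [N] the trivial bound [2 G] suffices, as [m ^ (- al) >= 1 / m >= 1 / N]. *)
have [Nm|mN] := leqP N m; last first.
  apply: (@le_trans _ _ ((G + G) * N%:R * m%:R `^ (- al))); last first.
    by rewrite ler_wpM2r // lerDr addr_ge0 ?mulr_ge0 ?addr_ge0 ?mulr_ge0.
  apply: (@le_trans _ _ (G + G)).
    apply: le_trans (ler_normB _ _) _; rewrite lerD ?gG //.
    by apply: norm_bern_le => // k km; apply: gG; exact: node01.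
  rewrite -mulrA ler_peMr ?addr_ge0 //.
  have : m%:R * m%:R^-1 <= N%:R * m%:R `^ (- al).
    by rewrite ler_pM ?invr_ge0 ?ler_nat ?(ltnW mN) // natr_powRN_ge // ltW.
  by rewrite divff // pnatr_eq0 -lt0n.
have nm : (m + s)%:R `^ (- al) <= m%:R `^ (- al).
  by apply: natr_powRN_le (ltW al0) => //; exact: leq_addr.
have h1 := bernstein_int_bern_holder M0 H1 m0 x01.
have h2 := HP m x (leq_trans Nm (leq_addr _ _)) x01.
have k0 : 0 <= C + c * (M * s%:R + 1) by rewrite !addr_ge0 ?mulr_ge0 ?addr_ge0 ?mulr_ge0.
have h3 := ler_wpM2l k0 nm.
have h4 : 0 <= (G + G) * N%:R * m%:R `^ (- al) by rewrite !mulr_ge0 ?addr_ge0.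
have -> : (B m).[x] - g x = (P (m + s) x - g x) - (P (m + s) x - (B m).[x]) by ring.
by apply: le_trans (ler_normB _ _) _; lra.
Qed.

End Rates.

Theorem corollary1p3 (R : realType) (rnd : R -> int) (s : nat) (alpha : R)
    (f : R -> R) :
  nearest_int rnd ->
  (0 < s)%N ->
  0 < alpha < 1 ->
  Cn01 s f ->
  f 0 \is a Num.int -> f 1 \is a Num.int ->
  deriv01 f 0 \is a Num.int -> deriv01 f 1 \is a Num.int ->
  (forall i, (2 <= i <= s)%N -> derivn01 i f 0 = 0 /\ derivn01 i f 1 = 0) ->
  ((fun n : nat =>
      norm01 (derivn01 s (bernstein_int rnd n f) \- derivn01 s f))
     =O_ \oo (fun n : nat => n%:R `^ (- alpha)))
  <->
  (omega2_phi (derivn01 s f) =O_ (0^'+) (fun h : R => h `^ (2 * alpha))) /\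
  (omega1 (derivn01 s f) =O_ (0^'+) (fun h : R => h `^ alpha)).
Proof.
move=> rndP s0 /andP[al0 al1] [Df cg] f0 f1 f'0 f'1 Hi.
have [G G0 gG] := continuous01_bounded cg.
have [c c0 Hc] := coef_estimate rndP s0 Df f0 f1 f'0 f'1 Hi gG.
split.
  exact: (inverse_rate s0 al0 al1 G0 gG c0 Hc cg).
by case; exact: (direct_rate s0 al0 al1 G0 gG c0 Hc).
Qed.
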